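(* Let $n\ge2$, let $\alpha,\beta\in\mathbb R^n$ each have pairwise distinct coordinates, and let $w=u\oplus v\in\mathbb R^{2n}$. Every real singular point of $C_w=\{h_w=0\}\subset\mathbf P^2_{\mathbb R}$ is an ordinary, totally real multiple point. All these points lie over the same real projective parameter $[y:t]$, if any exist. More precisely, let $[y:t]=[-c:1]$ ($c\in\mathbb R$) be a parameter at which an output root $a+b$ has multiplicity $r\ge2$, where $a,b$ are the roots of $P_{u-c\alpha}$, $P_{v-c\beta}$ producing it. Let $I=\{i:u_i-c\alpha_i=a\}$ and $J=\{j:v_j-c\beta_j=b\}$ be the maximal input blocks, and put $m=|I|$, $k=|J|$, so that $r=m+k-n$. Define the monic degree-$r$ polynomial $$Q_{I,J}(z)=\left(\frac{r!}{m!}\frac{d^{m-r}}{dz^{m-r}}P_{\alpha_I}(z)\right)\boxplus_r\left(\frac{r!}{k!}\frac{d^{k-r}}{dz^{k-r}}P_{\beta_J}(z)\right),$$ where $P_{\alpha_I}(z)=\prod_{i\in I}(z-\alpha_i)$ and $P_{\beta_J}(z)=\prod_{j\in J}(z-\beta_j)$. Its roots $\zeta_1<\cdots<\zeta_r$ are real and distinct. In the chart $t=1$, the tangent cone of $C_w$ at $[a+b:-c:1]$ is a nonzero scalar multiple of $\prod_{\ell=1}^r(X-\zeta_\ell Y)$, where $X=x-a-b$ and $Y=y+c$.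
   Context: $P_\alpha(x)=\prod_{i=1}^n(x-\alpha_i)$. Finite free additive convolution in degree $d\ge1$: for $p(x)=\sum_{k=0}^d(-1)^ka_kx^{d-k}$ and $q(x)=\sum_{k=0}^d(-1)^kb_kx^{d-k}$ with $a_0=b_0=1$, set $(p\boxplus_d q)(x)=\sum_{k=0}^d(-1)^kc_kx^{d-k}$ with $c_k=\sum_{i+j=k}\frac{(d-i)!(d-j)!}{d!(d-k)!}a_ib_j$. It preserves real-rootedness (Walsh). For $w=u\oplus v$, $h_w(x,y,t)=(P_{y\alpha+tu}\boxplus_nP_{y\beta+tv})(x)$, a real homogeneous polynomial of degree $n$ in $(x,y,t)$, monic in $x$. ''Output root at $[y:t]$'' means a root $x$ of $h_w(\cdot,y,t)$. Fujie's atom theorem: if an output root of $p\boxplus_nq$ ($p,q$ monic real-rooted of degree $n$) has multiplicity $r\ge2$, it equals $a+b$ for roots $a$ of $p$ and $b$ of $q$ with multiplicities $m,k$ satisfying $m+k-n=r$; these $a,b$ are ''the roots producing it''. An ordinary $r$-fold point is a point whose lowest-degree homogeneous term (tangent cone) in local affine coordinates is a product of $r$ pairwise distinct (nonproportional) linear forms; it is totally real when these forms can all be chosen over $\mathbb R$. *)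

(* Defs.v *)
From mathcomp Require Import all_boot all_order all_algebra.
From mathcomp Require Import reals.
From mathcomp Require Export mpoly.

Set Implicit Arguments.
Unset Strict Implicit.
Unset Printing Implicit Defensive.

Import Order.TTheory GRing.Theory Num.Theory.
Local Open Scope ring_scope.

Definition root_poly_on (A : comNzRingType) n (I : {set 'I_n}) (a : 'rV[A]_n) :
  {poly A} := \prod_(i in I) ('X - (a 0 i)%:P).

Definition root_poly (A : comNzRingType) n (a : 'rV[A]_n) : {poly A} :=
  \prod_(i < n) ('X - (a 0 i)%:P).

(* The coefficient a_k in p = \sum_(k <= d) (-1)^k a_k 'X^(d - k). *)
Definition alt_coef (A : comUnitRingType) (d : nat) (p : {poly A}) (k : nat) : A :=
  (-1) ^+ k * p`_(d - k).

(* Finite free additive convolution in degree d. It is stated over any ring in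
   which d`! is invertible, so that the same definition serves for real
   polynomials and for polynomials with coefficients in {mpoly R[3]}. *)
Definition ffconv_coef (A : comUnitRingType) (d : nat) (p q : {poly A}) (k : nat) : A :=
  \sum_(i < k.+1)
    ((d - i)`! * (d - (k - i))`!)%:R / (d`! * (d - k)`!)%:R
      * alt_coef d p i * alt_coef d q (k - i).

Definition ffconv (A : comUnitRingType) (d : nat) (p q : {poly A}) : {poly A} :=
  \sum_(k < d.+1) ((-1) ^+ k * ffconv_coef d p q k) *: 'X^(d - k).

(* Homogeneous coordinates [x : y : t] on the projective plane. *)
Definition cx : 'I_3 := @Ordinal 3 0 isT.
Definition cy : 'I_3 := @Ordinal 3 1 isT.
Definition ct : 'I_3 := @Ordinal 3 2 isT.
(* Affine coordinates in the chart t = 1. *)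
Definition cX : 'I_2 := @Ordinal 2 0 isT.
Definition cY : 'I_2 := @Ordinal 2 1 isT.

Definition pt (R : Type) (x y t : R) : 'I_3 -> R := tnth [tuple x; y; t].

(* The polynomial y a + t u, with coefficientwise embedding of constants. *)
Definition generic_input (R : realType) n (a u : 'rV[R]_n) : 'rV[{mpoly R[3]}]_n :=
  'X_cy *: map_mx (@mpolyC 3 R) a + 'X_ct *: map_mx (@mpolyC 3 R) u.

Definition curve_poly (R : realType) n (alpha beta u v : 'rV[R]_n) : {mpoly R[3]} :=
  (ffconv n (root_poly (generic_input alpha u))
            (root_poly (generic_input beta v))).['X_cx].

(* A point of the projective plane is given by nonzero homogeneous coordinates. *)
Definition proj_point (R : realType) n (P : 'I_n -> R) : Prop :=
  exists i, P i != 0.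

Definition singular_point (R : realType) (F : {mpoly R[3]}) (P : 'I_3 -> R) : Prop :=
  [/\ proj_point P, F.@[P] = 0 & forall i, (F^`M(i)).@[P] = 0].

(* [y0 : t0] and (P y : P t) are the same point of the projective line. *)
Definition lies_over (R : realType) (P : 'I_3 -> R) (y0 t0 : R) : Prop :=
  exists2 l : R, l != 0 & P cy = l * y0 /\ P ct = l * t0.

(* Equation of F = 0 in the affine chart where the k-th coordinate is 1, with
   the remaining coordinates (in increasing order) translated so that P becomes
   the origin. *)
Definition local_eq (R : realType) (F : {mpoly R[3]}) (P : 'I_3 -> R) (k : 'I_3) :
  {mpoly R[2]} :=
  F \mPo [tuple if unlift k j is Some i then (P j / P k)%:MP + 'X_i else 1
         | j < 3].

Definition lowest_form (R : realType) n (f : {mpoly R[n]}) (r : nat) (g : {mpoly R[n]}) :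
  Prop :=
  [/\ g != 0, pihomog mdeg r f = g &
      forall e, (e < r)%N -> pihomog mdeg e f = 0].

Definition ordinary_real_point (R : realType) (F : {mpoly R[3]}) (P : 'I_3 -> R)
    (r : nat) : Prop :=
  forall k, P k != 0 ->
  exists L : 'I_r -> {mpoly R[2]},
    [/\ forall i, L i \is 1.-homog,
        forall i j, i != j -> forall c : R, L i != c *: L j &
        lowest_form (local_eq F P k) r (\prod_(i < r) L i)].

(* a and b are the roots of p and q that produce the root a + b, of
   multiplicity r >= 2, of their convolution (Fujie). *)
Definition producing_roots (R : realType) (n : nat) (p q : {poly R}) (a b : R)
    (r : nat) : Prop :=
  [/\ root p a, root q b, mup (a + b) (ffconv n p q) = r, (2 <= r)%N &
      (mup a p + mup b q = n + r)%N].

(* The factors r`! / m`! and r`! / k`! make the derivatives monic; these have degree r. *)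
Definition block_poly (R : realType) n (alpha beta : 'rV[R]_n) (I J : {set 'I_n})
    (r : nat) : {poly R} :=
  let m := #|I| in
  let k := #|J| in
  ffconv r ((r`!%:R / m`!%:R) *: (root_poly_on I alpha)^`(m - r))
           ((r`!%:R / k`!%:R) *: (root_poly_on J beta)^`(k - r)).

(* Specializing the coefficients of h_w gives the pointwise definition
   h_w(x, y, t) = (P_(y alpha + t u) [+]_n P_(y beta + t v))(x). *)
Lemma curve_polyE (R : realType) n (alpha beta u v : 'rV[R]_n) (x y t : R) :
  (curve_poly alpha beta u v).@[pt x y t] =
  (ffconv n (root_poly (y *: alpha + t *: u))
            (root_poly (y *: beta + t *: v))).[x].
Proof.
have Einput a b : map_poly (meval (pt x y t)) (root_poly (generic_input a b))
    = root_poly (y *: a + t *: b) :> {poly R}.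
  rewrite /root_poly rmorph_prod /=; apply: eq_bigr => i _.
  rewrite rmorphB /= map_polyX map_polyC /= !mxE mevalD !mevalM !mevalXU !mevalC.
  by [].
have Enat (N : nat) : (N%:R : {mpoly R[3]})^-1 = (N%:R^-1)%:MP.
  have [->|N0] := posnP N; first by rewrite !invr0 mpolyC0.
  have NU : (N%:R : R) != 0 by rewrite pnatr_eq0 -lt0n.
  have E : (N%:R : {mpoly R[3]}) * (N%:R^-1)%:MP = 1.
    by rewrite -[N%:R]mpolyC_nat -mpolyCM divff.
  have U : (N%:R : {mpoly R[3]}) \is a GRing.unit.
    by apply/unitrPr; exists (N%:R^-1)%:MP.
  by apply: (mulrI U); rewrite divrr // E.
rewrite /curve_poly -horner_map /= mevalXU; congr (_.[_]).
rewrite -!Einput /ffconv rmorph_sum /=; apply: eq_bigr => k _.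
rewrite map_polyZ /= map_polyXn; congr (_ *: _).
rewrite rmorphM rmorph_sign /=; congr (_ * _).
rewrite /ffconv_coef rmorph_sum /=; apply: eq_bigr => i _.
have Ealt (p : {poly {mpoly R[3]}}) j : (alt_coef n p j).@[pt x y t] =
    alt_coef n (map_poly (meval (pt x y t)) p) j.
  by rewrite /alt_coef mevalM coef_map /= rmorph_sign.
have Eterm (N M l j : nat) (p q : {poly {mpoly R[3]}}) :
    (N%:R / M%:R * alt_coef n p l * alt_coef n q j).@[pt x y t] =
    N%:R / M%:R * alt_coef n (map_poly (meval (pt x y t)) p) l
      * alt_coef n (map_poly (meval (pt x y t)) q) j.
  by rewrite 2!mevalM !Ealt mevalM Enat mevalC rmorph_nat.

exact: Eterm.
Qed.

(* Main.v *)
(** The convolution in degree n is an iterated polar derivative: the value at x of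
    the convolution of prod_i (X - a_i) with q is, up to n!, the result of taking
    polar derivatives of q with respect to the points x - a_1, ..., x - a_n.
    Laguerre's theorem for the upper half-plane therefore gives real-rootedness.

    For a double output root x0, moving a single input root a keeps all output
    roots real, so by Laguerre's inequality f'^2 - f f'' >= 0 the first-order
    variation at x0 vanishes.  If two distinct multiple inputs a, c both had a
    nonzero second-order variation, they could be moved along a curve that keeps
    the double root while making a simple, which is impossible.  Induction on the
    degree then gives roots a and b of the inputs, of multiplicities m and k, with
    x0 = a + b and m + k >= n + 2.

    Centre the two inputs at a and b and scale all local variables by e.  Every
    block factor yields a factor e and every other factor is a unit modulo e, so
    h = e^(m+k-n) times the convolution of the block polynomials, modulo higher
    powers of e.  After dehomogenization the block polynomials convolve to a
    multiple of Q_{I,J}, whose roots are simple by the multiplicity bound applied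
    to simple inputs.  Two blocks belonging to different parameters c share at
    most one index, which forbids singular points over two parameters. *)

From HB Require Import structures.
Require Import Defs.
From mathcomp Require Import all_boot all_order all_algebra.
From mathcomp Require Import boolp reals.
From mathcomp Require Import ring lra zify.
From mathcomp Require Import complex.

Set Implicit Arguments.
Unset Strict Implicit.
Unset Printing Implicit Defensive.

Import Order.TTheory GRing.Theory Num.Theory.
Local Open Scope ring_scope.

Lemma fact_dvdn_fact m n : (m <= n)%N -> (m`! %| n`!)%N.
Proof.
by move=> le_mn; rewrite -(ffact_fact (leq_subr m n)) subKn // dvdn_mull.
Qed.

(** * The convolution without denominators *)

Section NConv.
Variable A : comNzRingType.
Implicit Types (p q : {poly A}) (N : nat).

(* N! times the convolution in degree N, which needs no division. *)
Definition nconv N p q : {poly A} :=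
  \sum_(s < N.+1) (s`!%:R * p`_s) *: q^`(N - s).

Lemma nconvDl N p1 p2 q : nconv N (p1 + p2) q = nconv N p1 q + nconv N p2 q.
Proof.
by rewrite -big_split; apply: eq_bigr => s _; rewrite coefD mulrDr scalerDl.
Qed.

Lemma nconvZl N a p q : nconv N (a *: p) q = a *: nconv N p q.
Proof.
by rewrite scaler_sumr; apply: eq_bigr => s _; rewrite coefZ scalerA mulrCA.
Qed.

Lemma nconvZr N a p q : nconv N p (a *: q) = a *: nconv N p q.
Proof.
rewrite scaler_sumr; apply: eq_bigr => s _.
by rewrite derivnZ !scalerA mulrC.
Qed.

Lemma nconvBl N p1 p2 q : nconv N (p1 - p2) q = nconv N p1 q - nconv N p2 q.
Proof. by rewrite nconvDl -scaleN1r nconvZl scaleN1r. Qed.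

(** The summand of index [N.+1] vanishes with the leading coefficient, and each remaining one
    carries one derivative more than in degree [N]. *)
Lemma nconv_lower N p q :
  (size p <= N.+1)%N -> nconv N.+1 p q = nconv N p q^`().
Proof.
move=> sp; rewrite /nconv big_ord_recr /= nth_default // mulr0 scale0r addr0.
apply: eq_bigr => s _; rewrite subSn ?derivSn //.
by rewrite -ltnS.
Qed.

Lemma deriv_nconvr N p q : (nconv N p q)^`() = nconv N p q^`().
Proof.
rewrite /nconv raddf_sum; apply: eq_bigr => s _ /=.
by rewrite derivZ -derivSn derivnS.
Qed.

Lemma coef_nconv N p q j : (nconv N p q)`_j =
  \sum_(s < N.+1) (s`!%:R * ((N - s + j) ^_ (N - s))%:R) * (p`_s * q`_(N - s + j)).
Proof.
rewrite coef_sum; apply: eq_bigr => s _.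
by rewrite coefZ coef_derivn -mulr_natl; ring.
Qed.

Lemma size_nconv N p q : (size q <= N.+1)%N -> (size (nconv N p q) <= N.+1)%N.
Proof.
move=> sq; apply/leq_sizeP => j lj; rewrite coef_nconv big1 // => s _.
rewrite (nth_default 0 (s:=q)) ?mulr0 ?mulr0 //.
by rewrite (leq_trans sq) //; lia.
Qed.

Lemma coefN_nconv N p q : (nconv N p q)`_N = N`!%:R * (p`_N * q`_N)
  + \sum_(s < N) (s`!%:R * ((N - s + N) ^_ (N - s))%:R) * (p`_s * q`_(N - s + N)).
Proof.
by rewrite coef_nconv big_ord_recr /= subnn ffactn0 mulr1 add0n addrC.
Qed.

Lemma lead_nconv N p q :
  (size q <= N.+1)%N -> (nconv N p q)`_N = N`!%:R * (p`_N * q`_N).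
Proof.
move=> sq; rewrite coefN_nconv big1 ?addr0 // => s _.
rewrite [q`_ _]nth_default ?mulr0 ?mulr0 // (leq_trans sq) //; have := ltn_ord s; lia.
Qed.

(** In the coefficient of degree [j], the weight of [p_s q_(N - s + j)] is [s! (N - s + j)! / j!],
    which is symmetric under the exchange of [s] and [N - s + j]; terms with [s < j] vanish because
    the index of [q] exceeds [N]. *)
Lemma nconvC N p q :
  (size p <= N.+1)%N -> (size q <= N.+1)%N -> nconv N p q = nconv N q p.
Proof.
move=> sp sq; apply/polyP => j.
have [lj|lj] := leqP N.+1 j.
  by rewrite !nth_default //; apply: leq_trans lj; apply: size_nconv.
have red (p1 q1 : {poly A}) : (size q1 <= N.+1)%N -> (nconv N p1 q1)`_j =
    \sum_(j <= s < N.+1) (s`!%:R * ((N - s + j)`! %/ j`!)%:R) * (p1`_s * q1`_(N - s + j)).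
  move=> sq1; rewrite coef_nconv -(big_mkord xpredT (fun s =>
    s`!%:R * ((N - s + j) ^_ (N - s))%:R * (p1`_s * q1`_(N - s + j)))).
  rewrite (big_cat_nat _ (n := j)) //= ?(ltnW lj) // big_nat_cond big1 ?add0r; last first.
    move=> s /andP[/andP[_ ls] _].
    by rewrite [q1`_ _]nth_default ?mulr0 ?mulr0 // (leq_trans sq1) //; lia.
  apply: eq_big_nat => s /andP[l1 l2].
  by rewrite ffact_factd ?leq_addr // addKn.
rewrite !red // [RHS]big_nat_rev /=; apply: eq_big_nat => s /andP[l1 l2].
have E1 : (j + N.+1 - s.+1 = N - s + j)%N by lia.
rewrite E1; have -> : (N - (N - s + j) + j = s)%N by lia.
rewrite -!natrM [q`_ _ * _]mulrC.
congr (_%:R * _).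
have d1 : (j`! %| s`!)%N by apply: fact_dvdn_fact.
have d2 : (j`! %| (N - s + j)`!)%N by apply: fact_dvdn_fact; lia.
by rewrite muln_divA // mulnC [in RHS]muln_divA //.
Qed.

Lemma size_deriv_leq p : (size p^`() <= (size p).-1)%N.
Proof. exact: size_poly. Qed.

Lemma deriv_nconvl N p q : (size p <= N.+1)%N -> (size q <= N.+1)%N ->
  (nconv N p q)^`() = nconv N p^`() q.
Proof.
move=> sp sq; rewrite (nconvC sp sq) deriv_nconvr nconvC //.
by apply: leq_trans (size_deriv_leq _) _; rewrite (leq_trans (leq_pred _)).
Qed.

Lemma derivn_comp_shift k p b :
  (p \Po ('X + b%:P))^`(k) = p^`(k) \Po ('X + b%:P).
Proof.
elim: k => [|k IH] //; rewrite !derivnS IH deriv_comp derivD derivX derivC.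
by rewrite addr0 mulr1.
Qed.

Lemma nconv_shiftr N p q b :
  nconv N p (q \Po ('X + b%:P)) = nconv N p q \Po ('X + b%:P).
Proof.
rewrite /nconv raddf_sum; apply: eq_bigr => s _ /=.
by rewrite derivn_comp_shift comp_polyZ.
Qed.

Lemma size_comp_shift p b : (size (p \Po ('X + b%:P)) <= size p)%N.
Proof.
have [->|p0] := eqVneq p 0; first by rewrite comp_poly0.
apply: leq_trans (size_comp_poly_leq _ _) _; rewrite size_XaddC muln1 prednK //.
by rewrite size_poly_gt0.
Qed.

Lemma nconv_shiftl N p q b : (size p <= N.+1)%N -> (size q <= N.+1)%N ->
  nconv N (p \Po ('X + b%:P)) q = nconv N p q \Po ('X + b%:P).
Proof.
move=> sp sq; rewrite nconvC ?nconv_shiftr 1?nconvC //.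
exact: leq_trans (size_comp_shift _ _) _.
Qed.

Lemma derivn_comp_scale k p e : (p \Po (e *: 'X))^`(k) = e ^+ k *: (p^`(k) \Po (e *: 'X)).
Proof.
elim: k => [|k IH]; first by rewrite expr0 scale1r.
rewrite !derivnS IH derivZ deriv_comp derivZ derivX exprSr -scalerA.
by rewrite -scalerAr mulr1.
Qed.

Lemma coef_comp_scale p e i : (p \Po (e *: 'X))`_i = e ^+ i * p`_i.
Proof.
rewrite coef_comp_poly.
under eq_bigr => j _ do rewrite exprZn coefZ coefXn.
have [l|l] := ltnP i (size p).
  rewrite (bigD1 (Ordinal l)) //= eqxx mulr1 big1 ?addr0 1?mulrC // => j.
  by rewrite -val_eqE /= eq_sym => /negPf ->; rewrite !mulr0.
rewrite nth_default // mulr0 big1 // => j _; case: eqP => [E|]; last by rewrite !mulr0.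
by have := ltn_ord j; rewrite -E ltnNge l.
Qed.

(** In the summand of index [s], the coefficient of [p] gives [e ^+ s] and the derivative of [q]
    gives [e ^+ (N - s)]; thus [e] need not be invertible. *)
Lemma nconv_scale N p q e :
  nconv N (p \Po (e *: 'X)) (q \Po (e *: 'X)) = e ^+ N *: (nconv N p q \Po (e *: 'X)).
Proof.
rewrite /nconv raddf_sum /= scaler_sumr; apply: eq_bigr => s _ /=.
rewrite derivn_comp_scale coef_comp_scale comp_polyZ !scalerA; congr (_ *: _).
have -> : e ^+ N = e ^+ s * e ^+ (N - s) by rewrite -exprD subnKC // -ltnS.
ring.
Qed.

(* The polar derivative at degree N.+1 with respect to the point z. *)
Definition polar N (z : A) q : {poly A} := N.+1%:R *: q + (z%:P - 'X) * q^`().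

Lemma derivn_polar N z q k : (k <= N)%N ->
  (polar N z q)^`(k) = (N.+1 - k)%:R *: q^`(k) + (z%:P - 'X) * q^`(k.+1).
Proof.
elim: k => [|k IH] lk; first by rewrite subn0.
rewrite derivnS IH; last exact: ltnW.
rewrite derivD derivZ derivM derivB derivC derivX -!derivnS sub0r mulN1r addrA.
congr (_ + _); rewrite -[X in _ - X]scale1r -scalerBl; congr (_ *: _).
have -> : (N.+1 - k)%N = (N.+1 - k.+1).+1 by rewrite subSS subSn // ltnW.
by rewrite -natr1 addrK.
Qed.

(** The engine of the inductions on the roots. In the derivative of order [N - s] of the polar, the
    factor [s + 1] turns [s!] into [(s + 1)!], matching the index shift caused by ['X], and at [x]
    the factor [x - a - x] is the [- a]. *)
Lemma horner_nconv_XsubC N a p q x : (size p <= N.+1)%N ->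
  (nconv N.+1 (('X - a%:P) * p) q).[x] = (nconv N p (polar N (x - a) q)).[x].
Proof.
move=> sp; rewrite mulrBl mul_polyC nconvBl nconvZl hornerD hornerN hornerZ (nconv_lower q sp).
have -> : nconv N.+1 ('X * p) q =
    \sum_(s < N.+1) (s.+1`!%:R * p`_s) *: q^`(N - s).
  rewrite /nconv big_ord_recl /= coefXM eqxx mulr0 scale0r add0r.
  by apply: eq_bigr => s _; rewrite coefXM.
rewrite !horner_sum mulr_sumr -sumrB; apply: eq_bigr => s _.
have ls : (s <= N)%N by rewrite -ltnS.
rewrite derivn_polar ?leq_subr // !hornerZ hornerD hornerZ hornerM.
rewrite !hornerE -derivSn factS natrM.
have -> : (N.+1 - (N - s) = s.+1)%N by lia.
rewrite /=; ring.
Qed.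

Lemma nconv_Xn N q : nconv N 'X^N q = N`!%:R *: q.
Proof.
rewrite /nconv big_ord_recr /= big1 ?add0r; first by rewrite coefXn eqxx mulr1 subnn.
move=> s _; rewrite coefXn; have := ltn_ord s; case: eqP => [->|]; rewrite ?ltnn //.
by rewrite mulr0 scale0r.
Qed.

End NConv.

Lemma map_nconv (A B : comNzRingType) (f : {rmorphism A -> B}) N (p q : {poly A}) :
  map_poly f (nconv N p q) = nconv N (map_poly f p) (map_poly f q).
Proof.
rewrite rmorph_sum; apply: eq_bigr => s _ /=.
by rewrite map_polyZ /= rmorphM rmorph_nat coef_map derivn_map.
Qed.

(** The index of the sum is reversed, as [alt_coef] counts coefficients from the top, and the signs
    of the two inputs cancel the outer sign. *)
Lemma ffconvE (A : comUnitRingType) N (p q : {poly A}) :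
    (forall k, (0 < k)%N -> (k%:R : A) \is a GRing.unit) ->
  (size p <= N.+1)%N -> (size q <= N.+1)%N ->
  N`!%:R *: ffconv N p q = nconv N p q.
Proof.
move=> U sp sq; apply/polyP => j; rewrite coefZ.
have [lj|lj] := leqP N.+1 j.
  rewrite [RHS]nth_default; last by apply: leq_trans lj; apply: size_nconv.
  rewrite coef_sum big1 ?mulr0 // => k _; rewrite coefZ coefXn.
  by case: eqP => [E|]; rewrite ?mulr0 ?mulr0 //; lia.
have lkj : (N - j < N.+1)%N by lia.
rewrite coef_sum (bigD1 (Ordinal lkj)) //= [X in _ + X]big1 ?addr0; last first.
  move=> k /eqP Nk; rewrite coefZ coefXn; case: eqP => [E|]; rewrite ?mulr0 //.
  by case: Nk; apply: val_inj => /=; have := ltn_ord k; lia.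
rewrite coefZ coefXn subKn // eqxx mulr1 /ffconv_coef.
have [jN sj] : (j <= N)%N /\ (N - j + j = N)%N by lia.
rewrite [RHS]coef_nconv -(big_mkord xpredT (fun s =>
    s`!%:R * ((N - s + j) ^_ (N - s))%:R * (p`_s * q`_(N - s + j)))).
rewrite big_nat_rev /= add0n.
rewrite (big_cat_nat _ (n := (N - j).+1)) //= [X in _ = _ + X]big_nat_cond.
rewrite [X in _ = _ + X]big1 ?addr0; last first.
  move=> i /andP[/andP[l1 l2] _].
  by rewrite [q`__]nth_default ?mulr0 ?mulr0 //; apply: leq_trans sq _; lia.
rewrite big_mkord !mulr_sumr; apply: eq_bigr => i _.
have li := ltn_ord i.
rewrite /alt_coef subSS.
have -> : (N - (N - i) = i)%N by lia.
have -> : (N - (N - j - i) = i + j)%N by lia.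
rewrite subKn // ffact_factd ?leq_addr // addKn.
set x := p`__; set y := q`__.
have Es : (-1) ^+ (N - j) = (-1) ^+ i * (-1) ^+ (N - j - i) :> A.
  by rewrite -exprD subnKC.
have d2 : (j`! %| (i + j)`!)%N by apply: fact_dvdn_fact; apply: leq_addl.
have [e /= Ee] := dvdnP d2.
rewrite Ee mulnK ?fact_gt0 // !natrM.
have UN : N`!%:R \is a @GRing.unit A by apply: U; rewrite fact_gt0.
have Uj : j`!%:R \is a @GRing.unit A by apply: U; rewrite fact_gt0.
rewrite invrM // Es.
have S1 := sqrr_sign A i; have S2 := sqrr_sign A (N - j - i).
set a := (-1) ^+ i in S1 *; set b := (-1) ^+ (N - j - i) in S2 *.
transitivity ((N`!%:R / N`!%:R) * (j`!%:R / j`!%:R) * (a ^+ 2) * (b ^+ 2)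
  * ((N - i)`!%:R * e%:R * (x * y))); first by ring.
by rewrite !divrr // S1 S2; ring.
Qed.

Lemma size_polar (A : comNzRingType) N (z : A) (q : {poly A}) :
  (size q <= N.+2)%N -> (size (polar N z q) <= N.+1)%N.
Proof.
move=> sq; apply/leq_sizeP => j lj.
rewrite /polar coefD coefZ mulrBl coefB mul_polyC coefZ coefXM !coef_deriv.
case: j lj => // j lj; have -> : q`_j.+2 = 0 by rewrite nth_default // (leq_trans sq).
rewrite /= mul0rn mulr0 sub0r.
case: (ltngtP N.+1 j.+1) lj => // [lj _|[->] _].
  by rewrite nth_default ?mulr0 ?mul0rn ?subrr // (leq_trans sq).
by rewrite mulr_natl subrr.
Qed.

Lemma polarZ (A : comNzRingType) N (z l : A) q :
  polar N z (l *: q) = l *: polar N z q.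
Proof. by rewrite /polar derivZ -scalerAr scalerDr !scalerA mulrC. Qed.

Notation root_prod s := (\prod_(a <- s) ('X - a%:P)).

(** * Laguerre's theorem and real-rootedness *)

Section UpperHalfPlane.
Variable C : numClosedFieldType.
Implicit Types (p q : {poly C}) (w y z : C) (s : seq C).

Definition no_upper_root q := forall w, 0 < 'Im w -> ~~ root q w.

Lemma normC2_sub_conj w y :
  `|y - w^*| ^+ 2 - `|y - w| ^+ 2 = 4%:R * ('Im y * 'Im w).
Proof. by rewrite !normC2_Re_Im !raddfB /= Re_conj Im_conj; ring. Qed.

Lemma norm_sub_conj_gt w z : 0 < 'Im w -> 0 < 'Im z -> `|w - z| < `|z - w^*|.
Proof.
move=> w0 z0; rewrite -(ltr_pXn2r (n := 2)) ?nnegrE ?normr_ge0 //.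
by rewrite (distrC w) -subr_gt0 normC2_sub_conj !mulr_gt0 ?ltr0n.
Qed.

Lemma norm_sub_conj_le w y : 0 < 'Im w -> 'Im y <= 0 -> `|y - w^*| <= `|w - y|.
Proof.
move=> w0 y0; rewrite -(ler_pXn2r (n := 2)) ?nnegrE ?normr_ge0 //.
rewrite (distrC w) -subr_le0 normC2_sub_conj pmulr_rle0 ?ltr0n //.
by rewrite pmulr_lle0.
Qed.

Lemma no_upper_root_split q : no_upper_root q ->
  exists2 s, q = lead_coef q *: root_prod s & forall y, y \in s -> 'Im y <= 0.
Proof.
move=> q0; have [s qE] := closed_field_poly_normal q; exists s => // y ys.
have [//|y0] := real_leP (Creal_Im y) (real0 _).
have := q0 _ y0; rewrite qE rootE hornerZ.
have : root (root_prod s) y by rewrite root_prod_XsubC.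
by rewrite rootE => /eqP ->; rewrite mulr0 eqxx.
Qed.

(** Gauss-Lucas for a half-plane: [q'/q] is a sum of terms [1 / (w - y)], each with negative
    imaginary part. Multiplying by the squared modulus of [q] avoids division. *)
Lemma Im_root_prod_deriv s w : (0 < size s)%N -> 0 < 'Im w ->
    (forall y, y \in s -> 'Im y <= 0) ->
  'Im ((root_prod s)^`().[w] * (root_prod s).[w]^*) < 0.
Proof.
move=> + w0; elim: s => // y s IH _ sI.
have y0 : 'Im y <= 0 by apply: sI; rewrite mem_head.
have wy : 0 < 'Im (w - y) by rewrite raddfB /= subr_gt0 (le_lt_trans y0).
have [s0|s0] := posnP (size s).
  rewrite (size0nil s0) big_seq1 derivB derivX derivC subr0 !hornerE ?mul1r.
  by rewrite ?hornerXsubC Im_conj oppr_lt0.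
have {}IH : 'Im ((root_prod s)^`().[w] * (root_prod s).[w]^*) < 0.
  by apply: IH => // z zs; apply: sI; rewrite in_cons zs orbT.
rewrite big_cons derivM derivB derivX derivC subr0 mul1r.
rewrite hornerD !hornerM hornerXsubC; move: IH; set G := root_prod s.
move=> IH; set d := w - y in wy *; set g := G.[w] in IH *; set g' := G^`().[w] in IH *.
have -> : (g + d * g') * (d * g)^* =
    `|g| ^+ 2 * d^* + `|d| ^+ 2 * (g' * g^*).
  by rewrite !normCK rmorphM; ring.
have rn (z : C) : `|z| ^+ 2 \is Num.real by rewrite rpredX ?normr_real.
rewrite raddfD /= (ImMl (rn g)) (ImMl (rn d)) Im_conj.
have g0 : g != 0.
  by apply: contraTN isT => /eqP g0; move: IH; rewrite g0 rmorph0 mulr0 raddf0 ltxx.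
have wy0 : d != 0.
  by apply: contraTN wy => /eqP ->; rewrite raddf0 ltxx.
by rewrite -oppr_gt0 opprD addr_gt0 // ?oppr_gt0 pmulr_rlt0 ?oppr_lt0 ?exprn_gt0 ?normr_gt0.
Qed.

(* [q'/q] is a sum of [size s] terms [1 / (w - y)], each in the closed disc
   with centre [1 / (2 i Im w)] whose boundary passes through 0. *)
Lemma log_deriv_disc s w : 0 < 'Im w -> (forall y, y \in s -> 'Im y <= 0) ->
  let c := (w - w^*)^-1 in let q := root_prod s in
  `|q^`().[w] - q.[w] * (size s)%:R * c| <= `|q.[w]| * (size s)%:R * `|c|.
Proof.
move=> w0 sI /=; set c := (w - w^*)^-1; have ww : w - w^* != 0.
  apply: contraTneq w0 => /(congr1 (fun z => 'Im z)); rewrite raddfB raddf0 /=.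
  by rewrite Im_conj opprK -mulr2n => /eqP; rewrite mulrn_eq0 /= => /eqP ->; rewrite ltxx.
elim: s sI => [_|y s IH sI] /=.
  by rewrite big_nil derivC hornerC !mulr0 !mul0r subr0 normr0.
have y0 : 'Im y <= 0 by apply: sI; rewrite mem_head.
have {}IH := IH (fun z zs => sI z (mem_behead (s := y :: s) zs)).
rewrite big_cons derivM derivB derivX derivC subr0 mul1r.
rewrite hornerD !hornerM hornerXsubC; move: IH; set G := root_prod s.
move=> IH; set g := G.[w] in IH *; set g' := G^`().[w] in IH *.
have -> : g + (w - y) * g' - (w - y) * g * (size s).+1%:R * c =
   (w - y) * (g' - g * (size s)%:R * c) + g * (1 - (w - y) * c).
  by rewrite -natr1; ring.
have -> : 1 - (w - y) * c = (y - w^*) * c.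
  by rewrite -[X in X - _](divff ww); rewrite /c; ring.
apply: le_trans (ler_normD _ _) _; rewrite !normrM -natr1.
have -> : `|w - y| * `|g| * ((size s)%:R + 1) * `|c| =
   `|w - y| * (`|g| * (size s)%:R * `|c|) + `|g| * (`|w - y| * `|c|) by ring.
apply: lerD; first by rewrite ler_wpM2l.
by rewrite ler_wpM2l // ler_wpM2r // norm_sub_conj_le.
Qed.

(** A root [w] of the polar derivative would give [q'/q = N.+1 / (w - z)] at [w]. The disc
    containing [q'/q] then puts [z] at least as close to the conjugate of [w] as to [w], impossible
    for [z] in the upper half-plane. *)
Lemma laguerre_upper N q z : (size q <= N.+2)%N -> no_upper_root q ->
  0 < 'Im z -> no_upper_root (polar N z q).
Proof.
move=> sq q0 z0 w w0; apply/negP; rewrite rootE.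
have [s qE sI] := no_upper_root_split q0.
have lq0 : lead_coef q != 0.
  rewrite lead_coef_eq0; apply: contraTneq isT => q00.
  by have := q0 _ w0; rewrite q00 root0.
have ss : (size s <= N.+1)%N.
  by move: sq; rewrite qE size_scale // size_prod_XsubC.
have P0 : (root_prod s).[w] != 0.
  by have := q0 _ w0; rewrite {1}qE rootE hornerZ mulf_eq0 (negPf lq0).
have := log_deriv_disc w0 sI; set G := root_prod s in qE P0 *.
rewrite qE polarZ hornerZ mulf_eq0 (negPf lq0) /polar /= hornerD hornerZ hornerM hornerD hornerN hornerC hornerX.
set c := (w - w^*)^-1; set g := G.[w] in P0 *; set g' := G^`().[w] => /= dsc E.
have ww : w - w^* != 0.
  apply: contraTneq w0 => /(congr1 (fun z => 'Im z)); rewrite raddfB raddf0 /=.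
  by rewrite Im_conj opprK -mulr2n => /eqP; rewrite mulrn_eq0 /= => /eqP ->; rewrite ltxx.
have c0 : c != 0 by rewrite invr_eq0.
(* When [q] has degree below [N.+1], the missing roots count as roots at infinity: each contributes
   0, a boundary point of the disc. *)
have {}dsc : `|g' - g * N.+1%:R * c| <= `|g| * N.+1%:R * `|c|.
  have -> : g' - g * N.+1%:R * c =
     (g' - g * (size s)%:R * c) - g * (N.+1 - size s)%:R * c.
    by rewrite natrB //; ring.
  apply: le_trans (ler_normB _ _) _.
  have -> : `|g| * N.+1%:R * `|c| =
      `|g| * (size s)%:R * `|c| + `|g| * (N.+1 - size s)%:R * `|c|.
    by rewrite natrB //; ring.
  by rewrite lerD // !normrM normr_nat.
have gw : (w - z) * g' = N.+1%:R * g.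
  by apply/eqP; rewrite -subr_eq0 -oppr_eq0 -(eqP E); apply/eqP; ring.
have {}dsc : `|w - z| * `|g' - g * N.+1%:R * c| <= `|w - z| * (`|g| * N.+1%:R * `|c|).
  by rewrite ler_wpM2l.
move: dsc; rewrite -normrM mulrBr gw.
have -> : N.+1%:R * g - (w - z) * (g * N.+1%:R * c) = g * N.+1%:R * c * (z - w^*).
  by rewrite -{1}[g]mulr1 -(divff ww) -/c; ring.
rewrite !normrM normr_nat [leRHS]mulrC ler_pM2l ?mulr_gt0 ?normr_gt0 ?ltr0n //.
by move=> /(lt_le_trans (norm_sub_conj_gt w0 z0)); rewrite ltxx.
Qed.

Lemma no_upper_root_nconv s q x : (size q <= (size s).+1)%N -> no_upper_root q ->
  (forall a, a \in s -> 0 < 'Im (x - a)) -> (nconv (size s) (root_prod s) q).[x] != 0.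
Proof.
elim: s q => [|a s IH] q sq q0 xs.
  (* The constant polynomial [q] has no root at ['i]. *)
  rewrite /nconv /= big_ord1 big_nil coef1 mulr1 scale1r.
  have : ~~ root q 'i by apply: q0; rewrite Im_i.
  by rewrite (size1_polyC sq) rootE !hornerC.
have xa : 0 < 'Im (x - a) by apply: xs; rewrite mem_head.
rewrite big_cons /= horner_nconv_XsubC ?size_prod_XsubC //.
apply: IH; first exact: size_polar.
  exact: laguerre_upper.
by move=> b bs; apply: xs; rewrite in_cons bs orbT.
Qed.

End UpperHalfPlane.

(** * Real polynomials: Walsh's theorem and Laguerre's inequality *)

Section RealRooted.
Variable R : rcfType.
Implicit Types (p q : {poly R}) (s t z : seq R) (a b x : R).

Local Notation toC := (map_poly (real_complex R)).

(** Conjugation permutes the complex roots of a real polynomial, so none lies in the lower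
    half-plane either. *)
Lemma split_no_upper_root p : no_upper_root (toC p) ->
  exists s, p = lead_coef p *: root_prod s.
Proof.
move=> p0; have [p00|pn0] := eqVneq p 0.
  by exists [::]; rewrite p00 lead_coef0 scale0r.
have [s pE sI] := no_upper_root_split p0; exists (map (@complex.Re R) s).
have sR (z : R[i]) : z \in s -> z = (complex.Re z)%:C%C.
  move=> zs; have rz : root (toC p) z.
    rewrite pE rootE hornerZ; have : root (root_prod s) z by rewrite root_prod_XsubC.
    by rewrite rootE => /eqP ->; rewrite mulr0.
  have rzc : root (toC p) z^*%C.
    have E : toC p = map_poly (@conjc R) (toC p).
      by apply/polyP => i; rewrite [RHS]coef_map_id0 ?conjc0 // coef_map conjc_real.
    by rewrite E rootE horner_map (eqP rz) rmorph0.
  have Iz : complex.Im z = 0.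
    apply/le_anti/andP; split.
      by have := sI _ zs; rewrite -complexIm -(rmorph0 (real_complex R)) lecR.
    rewrite leNgt; apply: contraL rzc => z0; apply: p0.
    by rewrite -complexIm -(rmorph0 (real_complex R)) ltcR; case: (z) z0 => ? ? /=; rewrite oppr_gt0.
  by case: (z) Iz => u v /= ->.
apply: (map_poly_inj (real_complex R)).
rewrite {1}pE map_polyZ lead_coef_map; congr (_ *: _).
rewrite rmorph_prod big_map /= big_seq [RHS]big_seq; apply: eq_bigr => z zs.
by rewrite rmorphB /= map_polyX map_polyC /= -sR.
Qed.

Lemma toC_root_prod s : toC (root_prod s) = root_prod (map (real_complex R) s).
Proof.
rewrite rmorph_prod big_map; apply: eq_bigr => a _.
by rewrite rmorphB /= map_polyX map_polyC.
Qed.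

Lemma Im_real a : 'Im (a%:C)%C = 0.
Proof. by rewrite -complexIm. Qed.

Lemma no_upper_root_root_prod s : no_upper_root (toC (root_prod s)).
Proof.
move=> w w0; rewrite toC_root_prod root_prod_XsubC; apply/negP => /mapP [a _ wE].
by move: w0; rewrite wE Im_real ltxx.
Qed.

(** Walsh's theorem: for real [a], the point [w - a] stays in the upper half-plane together with
    [w], so [no_upper_root_nconv] excludes roots there. *)
Lemma nconv_split N s t : size s = N -> size t = N ->
  exists2 z, size z = N & nconv N (root_prod s) (root_prod t) = N`!%:R *: root_prod z.
Proof.
move=> ss st.
have f0 : N`!%:R != 0 :> R by rewrite pnatr_eq0 -lt0n fact_gt0.
have szt : (size (root_prod t) <= N.+1)%N by rewrite size_prod_XsubC st.
have lN (z : seq R) k : size z = k -> (root_prod z)`_k = 1.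
  move=> sz; have := monic_prod_XsubC z xpredT id.
  by rewrite monicE lead_coefE size_prod_XsubC sz /= => /eqP.
have lf : (nconv N (root_prod s) (root_prod t))`_N = N`!%:R.
  by rewrite lead_nconv // !lN // !mulr1.
have sf : size (nconv N (root_prod s) (root_prod t)) = N.+1.
  apply/eqP; rewrite eqn_leq size_nconv // ltnNge; apply/negP => le.
  by move: lf; rewrite nth_default // => /esym/eqP; rewrite (negPf f0).
have [z fE] : exists z, nconv N (root_prod s) (root_prod t) =
    lead_coef (nconv N (root_prod s) (root_prod t)) *: root_prod z.
  apply: split_no_upper_root => w w0.
  rewrite map_nconv !toC_root_prod -ss -(size_map (real_complex R) s) rootE.
  apply: no_upper_root_nconv.
  - by rewrite size_prod_XsubC !size_map st ss.
  - by rewrite -toC_root_prod; apply: no_upper_root_root_prod.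
  - by move=> _ /mapP [a _ ->]; rewrite raddfB /= Im_real subr0.
move: fE; rewrite lead_coefE sf /= lf => fE; exists z => //.
by move: sf; rewrite fE size_scale // size_prod_XsubC => -[].
Qed.

Lemma deriv_split N t : size t = N.+1 ->
  exists2 z, size z = N & (root_prod t)^`() = N.+1%:R *: root_prod z.
Proof.
move=> st; set f := _^`().
have lf : f`_N = N.+1%:R.
  have := monic_prod_XsubC t xpredT id; rewrite coef_deriv.
  by rewrite monicE lead_coefE size_prod_XsubC st /= => /eqP ->.
have sf : size f = N.+1.
  apply/eqP; rewrite eqn_leq ltnNge; apply/andP; split.
    by apply: leq_trans (size_deriv_leq _) _; rewrite size_prod_XsubC st.
  by apply/negP => le; move: lf; rewrite nth_default // => /esym/eqP; rewrite pnatr_eq0.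
have [z fE] : exists z, f = lead_coef f *: root_prod z.
  apply: split_no_upper_root => w w0.
  rewrite -deriv_map /= toC_root_prod; apply/negP => /eqP fw.
  have := @Im_root_prod_deriv _ (map (real_complex R) t) w.
  rewrite fw mul0r raddf0 ltxx size_map st => F; suff: false by [].
  by apply: F => // _ /mapP [a _ ->]; rewrite Im_real.
move: fE; rewrite lead_coefE sf /= lf => fE; exists z => //.
by move: sf; rewrite fE size_scale ?pnatr_eq0 // size_prod_XsubC => -[].
Qed.

(** Away from the roots the expression is [p ^ 2] times the sum of the [1 / (x - a) ^ 2]; the
    induction keeps this as a sum of squares without dividing. *)
Lemma laguerre_ge0 s x : let p := root_prod s in
  0 <= p^`().[x] ^+ 2 - p.[x] * p^`()^`().[x].
Proof.
elim: s => [|a s IH] /=; first by rewrite big_nil derivC linear0 !horner0 expr0n mulr0 subr0.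
rewrite big_cons derivM derivXsubC mul1r derivD derivM derivXsubC mul1r.
rewrite !hornerE /=; move: IH; rewrite /=; set p := root_prod s => IH.
set u := p.[x] in IH *; set v := p^`().[x] in IH *; set w := p^`()^`().[x] in IH *.
rewrite [leRHS](_ : _ = u ^+ 2 + (x - a) ^+ 2 * (v ^+ 2 - u * w)); last by ring.
by rewrite addr_ge0 ?sqr_ge0 // mulr_ge0 ?sqr_ge0.
Qed.

Lemma laguerre_gt0 s x : let p := root_prod s in
  (0 < size s)%N -> p.[x] != 0 -> 0 < p^`().[x] ^+ 2 - p.[x] * p^`()^`().[x].
Proof.
case: s => // a s /= _; have := laguerre_ge0 s x.
rewrite big_cons derivM derivXsubC mul1r derivD derivM derivXsubC mul1r.
rewrite !hornerE /=; set p := root_prod s => IH.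
set u := p.[x] in IH *; set v := p^`().[x] in IH *; set w := p^`()^`().[x] in IH *.
rewrite mulf_eq0 negb_or => /andP[_ u0].
rewrite [ltRHS](_ : _ = u ^+ 2 + (x - a) ^+ 2 * (v ^+ 2 - u * w)); last by ring.
by apply: (ltr_wpDr (mulr_ge0 (sqr_ge0 _) IH)); rewrite exprn_even_gt0.
Qed.

Lemma root_prod_neq0 s : root_prod s != 0 :> {poly R}.
Proof. by rewrite monic_neq0 // monic_prod_XsubC. Qed.

Lemma mup_root_prod a s : mup a (root_prod s) = count_mem a s.
Proof.
elim: s => [|b s IH]; first by rewrite big_nil mupNroot // rootE hornerC oner_eq0.
rewrite big_cons mupM ?root_prod_neq0 ?polyXsubC_eq0 // IH /=; congr (_ + _)%N.
by rewrite -[X in mup _ X]expr1 mup_XsubCX eq_sym; case: (_ == _).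
Qed.

(** A multiple root of [p'] is a root of [p], since otherwise the strict Laguerre inequality would
    read [0 < 0]; differentiation then lowers its multiplicity by exactly one. *)
Lemma count_deriv N t z c a : size t = N -> c != 0 ->
    (root_prod t)^`() = c *: root_prod z -> (2 <= count_mem a z)%N ->
  (count_mem a z < count_mem a t)%N.
Proof.
move=> st c0 E az; have at0 : root (root_prod t) a.
  apply/negPn/negP => nr.
  have t0 : (0 < size t)%N.
    case: (t) E => //; rewrite big_nil derivC => /esym/eqP.
    by rewrite scaler_eq0 (negPf c0) (negPf (root_prod_neq0 z)).
  have := laguerre_gt0 (x := a) t0; rewrite -rootE => /(_ nr); rewrite E.
  have : (('X - a%:P) ^+ 2 %| root_prod z) by rewrite -mup_geq ?root_prod_neq0 // mup_root_prod.
  move=> /dvdpP [q ->].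
  have -> : (c *: (q * ('X - a%:P) ^+ 2)).[a] = 0.
    by rewrite hornerZ hornerM horner_exp hornerXsubC subrr expr0n /= !mulr0.
  have -> : (c *: (q * ('X - a%:P) ^+ 2))^`().[a] = 0.
    rewrite derivZ hornerZ derivM deriv_exp derivXsubC mul1r hornerD !hornerM hornerMn !horner_exp.
    by rewrite hornerXsubC subrr !expr0n /= mul0rn !mulr0 addr0 mulr0.
  by rewrite expr0n mulr0 subr0 ltxx.
have [m [q nq tE]] := multiplicity_XsubC (root_prod t) a.
rewrite root_prod_neq0 /= in nq.
case: m tE => [|m] tE.
  by move: nq; rewrite -(mulr1 q) -(expr0 ('X - a%:P)) -tE at0.
have mt : count_mem a t = m.+1 by rewrite -mup_root_prod tE mupMr // mup_XsubCX eqxx.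
suff mz : count_mem a z = m by rewrite mt mz.
have q' : ~~ root (q^`() * ('X - a%:P) + m.+1%:R *: q) a.
  by rewrite rootE !hornerE subrr mulr0 add0r mulf_neq0 // pnatr_eq0.
have : c *: root_prod z = (q^`() * ('X - a%:P) + m.+1%:R *: q) * ('X - a%:P) ^+ m.
  by rewrite -E tE derivM deriv_exp derivXsubC mul1r scaler_nat mulrDl -mulrA -exprS mulrnAl mulrnAr.
rewrite -mul_polyC => /(congr1 (mup a)); rewrite [in RHS]mupMr // mup_XsubCX eqxx mupMr.
  by rewrite mup_root_prod.
by rewrite rootE hornerC.
Qed.

Lemma deriv_root_prod s :
  (root_prod s)^`() = \sum_(c <- s) root_prod (rem c s) :> {poly R}.
Proof.
elim: s => [|a s IH]; first by rewrite !big_nil derivC.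
rewrite !big_cons derivM derivXsubC mul1r IH /= eqxx; congr (_ + _).
rewrite mulr_sumr big_seq [RHS]big_seq; apply: eq_bigr => c cs.
case: eqP => [->|_]; last by rewrite big_cons.
by rewrite [RHS](perm_big _ (perm_to_rem cs)) big_cons.
Qed.

End RealRooted.

(** * Multiple roots of the convolution *)

Section DoubleRoot.
Variable R : rcfType.
Implicit Types (p q : {poly R}) (s t z : seq R) (a b e x : R).

Lemma quadratic_ge0_lin (K L : R) : (forall e, 0 <= e ^+ 2 * K + e * L) -> L = 0.
Proof.
move=> H; apply/eqP/negPn/negP => L0.
have D0 : 0 < K ^+ 2 + 1 by rewrite ltr_wpDl ?sqr_ge0.
have KD : K < K ^+ 2 + 1 by nra.
(* The denominator is positive and exceeds [K] whatever the sign of [K], so this [e] makes the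
   expression negative when [L] is nonzero. *)
have := H (- L / (K ^+ 2 + 1)).
have -> : (- L / (K ^+ 2 + 1)) ^+ 2 * K + - L / (K ^+ 2 + 1) * L =
   (L / (K ^+ 2 + 1)) ^+ 2 * (K - (K ^+ 2 + 1)) by field; rewrite gt_eqF.
rewrite pmulr_rge0 ?subr_ge0 ?leNgt ?KD //.
by rewrite exprn_even_gt0 //= mulf_neq0 // invr_eq0 gt_eqF.
Qed.

Lemma exists_nonroot p : p != 0 -> exists x, ~~ root p x.
Proof.
move=> p0; pose s := [seq i%:R | i <- iota 0 (size p)] : seq R.
have [pr|/allPn [x _ xp]] := boolP (all (root p) s); last by exists x.
have us : uniq s.
  by rewrite map_inj_uniq ?iota_uniq // => i j /eqP; rewrite eqr_nat => /eqP.
by have := max_poly_roots p0 pr us; rewrite size_map size_iota ltnn.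
Qed.

Lemma root_prod_cons_shift a e s :
  root_prod (a + e :: s) = root_prod (a :: s) - e *: root_prod s.
Proof. by rewrite !big_cons polyCD -mul_polyC; ring. Qed.

Section FixedFactor.
Variables (N : nat) (t : seq R) (x : R).
Hypothesis st : size t = N.+1.
Local Notation q := (root_prod t).
Local Notation v0 p := (nconv N.+1 p q).[x].
Local Notation v1 p := (nconv N.+1 p q)^`().[x].
Local Notation v2 p := (nconv N.+1 p q)^`()^`().[x].

Lemma horner_nconvBZ p p' e : v0 (p - e *: p') = v0 p - e * v0 p'.
Proof. by rewrite nconvBl nconvZl hornerD hornerN hornerZ. Qed.

Lemma horner_deriv_nconvBZ p p' e : v1 (p - e *: p') = v1 p - e * v1 p'.
Proof. by rewrite nconvBl nconvZl derivB derivZ hornerD hornerN hornerZ. Qed.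

Lemma horner_deriv2_nconvBZ p p' e : v2 (p - e *: p') = v2 p - e * v2 p'.
Proof. by rewrite nconvBl nconvZl !derivB !derivZ hornerD hornerN hornerZ. Qed.

(* Moving one root of the first factor keeps the convolution real-rooted; by
   Laguerre's inequality the first-order variation at an exact double root vanishes. *)
Lemma double_root_partial a s : size s = N ->
    v0 (root_prod (a :: s)) = 0 -> v1 (root_prod (a :: s)) = 0 ->
    v2 (root_prod (a :: s)) != 0 ->
  v0 (root_prod s) = 0.
Proof.
move=> ss f0 f1 f2; set f := root_prod (a :: s) in f0 f1 f2; set g := root_prod s.
suff /eqP : v0 g * v2 f = 0 by rewrite mulf_eq0 (negPf f2) orbF => /eqP.
(* Replacing [a] by [a + e] changes [f] into [f - e *: g]. As [f] vanishes doubly at [x], Laguerre's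
   expression there is this quadratic in [e], with linear coefficient [v0 g * v2 f]. *)
apply: (@quadratic_ge0_lin (v1 g ^+ 2 - v0 g * v2 g)) => e.
have sa : size (a + e :: s) = N.+1 by rewrite /= ss.
have [z _] := nconv_split sa st.
rewrite root_prod_cons_shift -/f -/g => fz.
have := horner_nconvBZ f g e; have := horner_deriv_nconvBZ f g e; have := horner_deriv2_nconvBZ f g e.
rewrite fz !derivZ !hornerZ f0 f1 !sub0r => E2 E1 E0.
have := mulr_ge0 (sqr_ge0 N.+1`!%:R) (laguerre_ge0 z x).
set c := N.+1`!%:R in E0 E1 E2 *; rewrite /=.
set z0 := _.[x] in E0 *; set z1 := _^`().[x] in E1 *; set z2 := _^`()^`().[x] in E2 *.
have -> : c ^+ 2 * (z1 ^+ 2 - z0 * z2) = (c * z1) ^+ 2 - (c * z0) * (c * z2) by ring.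
rewrite E0 E1 E2; congr (_ <= _); ring.
Qed.

Definition exact_double s :=
  [/\ v0 (root_prod s) = 0, v1 (root_prod s) = 0 & v2 (root_prod s) != 0].

Lemma exact_double_perm s s' : perm_eq s s' -> exact_double s -> exact_double s'.
Proof. by move=> pe [h0 h1 h2]; split; rewrite -(perm_big _ pe). Qed.

(** Both first-order variations vanish, and their difference is [c - a] times the mixed second-order
    one, up to sign. *)
Lemma double_root_partial2 a c s : (size s).+1 = N -> a != c ->
  exact_double (a :: c :: s) -> v0 (root_prod s) = 0.
Proof.
move=> ss ac D; have [h0 h1 h2] := D.
have ss' d : size (d :: s) = N by [].
have ga := double_root_partial (ss' c) h0 h1 h2.
have [] := exact_double_perm (s' := c :: a :: s) _ D.
  by rewrite -(cat1s a) -(cat1s c) perm_catCA.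
move=> h0' h1' h2'; have gc := double_root_partial (ss' a) h0' h1' h2'.
have E : root_prod (c :: s) = root_prod (a :: s) - (c - a) *: root_prod s.
  by rewrite -root_prod_cons_shift; congr (root_prod (_ :: _)); ring.
move: ga; rewrite E horner_nconvBZ gc sub0r => /eqP.
by rewrite oppr_eq0 mulf_eq0 subr_eq0 eq_sym (negPf ac) => /eqP.
Qed.

(** The derivative of [root_prod s] is the sum of the products with one more root [c] removed. As
    [a] is simple, every [c] differs from [a], and each term vanishes by [double_root_partial2]. *)
Lemma double_root_simple a s : size s = N -> a \notin s ->
  exact_double (a :: s) -> v1 (root_prod s) = 0.
Proof.
move=> ss aNs D; rewrite deriv_nconvl ?size_prod_XsubC ?ss ?st //.
rewrite deriv_root_prod.
have -> : nconv N.+1 (\sum_(c <- s) root_prod (rem c s)) q =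
    \sum_(c <- s) nconv N.+1 (root_prod (rem c s)) q.
  elim: (s) {2 4}s => [|c r IH] s'; last by rewrite !big_cons nconvDl IH.
  rewrite !big_nil /nconv big1 // => i _; by rewrite coef0 mulr0 scale0r.
rewrite horner_sum big_seq big1 // => c cs.
apply: (@double_root_partial2 a c).
- by rewrite size_rem // prednK // -has_predT; apply/hasP; exists c.
- by apply: contraNneq aNs => ->.
- by apply: exact_double_perm D; rewrite perm_cons perm_to_rem.
Qed.

(* Moving [a] and [c] simultaneously by [e] and [d(e)] keeps a double root
   at [x] and makes [a + e] simple, which contradicts [double_root_simple]. *)
Lemma double_root_two_blocks a c s : (size s).+1 = N -> a != c ->
  exact_double (a :: c :: s) ->
  v1 (root_prod (c :: s)) = 0 \/ v1 (root_prod (a :: s)) = 0.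
Proof.
move=> ss ac D; have [h0 h1 h2] := D.
have ss' d : size (d :: s) = N by [].
have [->|Ga0] := eqVneq (v1 (root_prod (c :: s))) 0; first by left.
have [->|Gc0] := eqVneq (v1 (root_prod (a :: s))) 0; first by right.
have k0 := double_root_partial2 ss ac D.
have g0 := double_root_partial (ss' c) h0 h1 h2.
have g0' : v0 (root_prod (a :: s)) = 0.
  have [] := exact_double_perm (s' := c :: a :: s) _ D.
    by rewrite -(cat1s a) -(cat1s c) perm_catCA.
  exact: double_root_partial (ss' a).
set Ga := v1 (root_prod (c :: s)) in Ga0.
set Gc := v1 (root_prod (a :: s)) in Gc0.
set T := v1 (root_prod s); set F2 := v2 (root_prod (a :: c :: s)) in h2.
set U := v2 (root_prod (c :: s)); set V := v2 (root_prod (a :: s)); set K := v2 (root_prod s).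
(* Genericity conditions on [e]: [PD] is the denominator of [d]; [P1] and [P2] keep [a + e] away
   from [c + d] and from [s]; [P3] keeps the second derivative at [x] nonzero. [P1] and [P3] are
   cleared of the denominator of [d]. *)
pose PD : {poly R} := Gc%:P - T *: 'X.
pose P1 : {poly R} := ((a - c)%:P + 'X) * PD + Ga *: 'X.
pose P2 : {poly R} := \prod_(d <- s) ((a - d)%:P + 'X).
pose P3 : {poly R} := (F2%:P - U *: 'X) * PD + (Ga * V) *: 'X - (Ga * K) *: 'X^2.
have nz (p : {poly R}) : p.[0] != 0 -> p != 0.
  by apply: contra_neq => ->; rewrite horner0.
have PDx y : PD.[y] = Gc - y * T.
  by rewrite hornerD hornerN hornerZ hornerC hornerX mulrC.
have P1x y : P1.[y] = (a - c + y) * (Gc - y * T) + Ga * y.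
  by rewrite hornerD hornerM PDx hornerZ hornerD hornerC hornerX.
have P3x y : P3.[y] = (F2 - U * y) * (Gc - y * T) + Ga * V * y - Ga * K * y ^+ 2.
  by rewrite !hornerD hornerM PDx !hornerN !hornerZ hornerD hornerN hornerZ hornerC hornerX hornerXn.
have PD0 : PD != 0 by apply: nz; rewrite PDx mul0r subr0.
have P10 : P1 != 0.
  by apply: nz; rewrite P1x mul0r mulr0 subr0 !addr0 mulf_neq0 // subr_eq0.
have P30 : P3 != 0.
  by apply: nz; rewrite P3x expr0n /= mul0r !mulr0 !subr0 addr0 mulf_neq0.
have P20 : P2 != 0.
  rewrite prodf_seq_neq0; apply/allP => d _ /=.
  by rewrite addrC -size_poly_eq0 size_XaddC.
have [e] : exists e, ~~ root (PD * P1 * P2 * P3) e.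
  by apply: exists_nonroot; rewrite !mulf_neq0.
rewrite !rootM !negb_or => /andP[/andP[/andP[eD e1] e2] e3].
have {}eD : Gc - e * T != 0.
  by move: eD; rewrite rootE PDx.
(* The value at [x] vanishes for all [e] and [d]; this [d] solves [d * Gc + e * Ga = e * d * T],
   which makes the first derivative vanish too. *)
pose d := - e * Ga / (Gc - e * T).
have dE : d * (Gc - e * T) = - e * Ga by rewrite /d mulfVK.
have dd : (a + e - (c + d)) != 0.
  apply: contraNneq e1 => E; rewrite rootE P1x.
  have {E} -> : a - c + e = d by rewrite -[RHS]add0r -E; ring.
  by rewrite dE; apply/eqP; ring.
have ae : a + e \notin c + d :: s.
  rewrite in_cons negb_or -subr_eq0 dd /=; apply: contra e2 => aes.
  rewrite rootE /P2 horner_prod prodf_seq_eq0; apply/hasP; exists (a + e) => //=.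
  by rewrite !hornerE; apply/eqP; ring.
have Es : root_prod (a + e :: c + d :: s) =
    (root_prod (a :: c :: s) - d *: root_prod (a :: s)) - e *: (root_prod (c :: s) - d *: root_prod s).
  rewrite root_prod_cons_shift root_prod_cons_shift; congr (_ - _).
  by rewrite !big_cons polyCD -!mul_polyC; ring.
have D' : exact_double (a + e :: c + d :: s).
  split; rewrite Es.
  - by rewrite !horner_nconvBZ h0 g0' g0 k0; ring.
  - rewrite !horner_deriv_nconvBZ h1 -/Ga -/Gc -/T.
    have -> : 0 - d * Gc - e * (Ga - d * T) = - (d * (Gc - e * T)) - e * Ga by ring.
    by rewrite dE; ring.
  rewrite horner_deriv2_nconvBZ horner_deriv2_nconvBZ horner_deriv2_nconvBZ -/F2 -/U -/V -/K; apply: contra e3 => /eqP E.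
  rewrite rootE P3x; apply/eqP.
  transitivity ((F2 - d * V - e * (U - d * K)) * (Gc - e * T)); last by rewrite E mul0r.
  transitivity ((F2 - e * U) * (Gc - e * T) - (d * (Gc - e * T)) * (V - e * K)); last by ring.
  by rewrite dE; ring.
have := double_root_simple (ss' (c + d)) ae D'.
rewrite root_prod_cons_shift horner_deriv_nconvBZ -/Ga -/T => E.
(* By the choice of [d], the product [(Ga - d * T) * (Gc - e * T)] equals [Ga * Gc], independently
   of [e]. *)
have : Ga * Gc = 0.
  transitivity ((Ga - d * T) * (Gc - e * T)); last by rewrite E mul0r.
  transitivity (Ga * (Gc - e * T) - d * (Gc - e * T) * T); last by ring.
  by rewrite dE; ring.
by move=> /eqP; rewrite mulf_eq0 (negPf Ga0) (negPf Gc0).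
Qed.

End FixedFactor.

Lemma count_double_root t b :
  (root_prod t).[b] = 0 -> (root_prod t)^`().[b] = 0 -> (2 <= count_mem b t)%N.
Proof.
move=> /eqP; rewrite -rootE root_prod_XsubC => bt.
rewrite (perm_big _ (perm_to_rem bt)) big_cons derivM derivXsubC mul1r.
rewrite hornerD hornerM hornerXsubC subrr mul0r addr0 => /eqP.
rewrite -rootE root_prod_XsubC => brt.
by rewrite (permP (perm_to_rem bt)) /= eqxx add1n ltnS -has_count has_pred1.
Qed.

Theorem nconv_double_root N s t x : size s = N -> size t = N ->
    (nconv N (root_prod s) (root_prod t)).[x] = 0 ->
    (nconv N (root_prod s) (root_prod t))^`().[x] = 0 ->
  exists a b, x = a + b /\ (N + 2 <= count_mem a s + count_mem b t)%N.
Proof.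
elim: N s t => [|N IH] s t ss st f0 f1.
  move: f0; rewrite (size0nil ss) (size0nil st) big_nil -{1}(expr0 'X).
  by rewrite nconv_Xn scale1r hornerC => /eqP; rewrite oner_eq0.
have Nn0 : N.+1%:R != 0 :> R by rewrite pnatr_eq0.
have [t' st' tE] := deriv_split st.
have lower (r : seq R) : size r = N ->
    nconv N.+1 (root_prod r) (root_prod t) = N.+1%:R *: nconv N (root_prod r) (root_prod t').
  by move=> sr; rewrite nconv_lower ?size_prod_XsubC ?sr // tE nconvZr.
(* Since [a] occurs at most [N] times in [r], the bound makes [b] at least double in [t'];
   [count_deriv] then supplies the extra unit when passing from [t'] to [t]. *)
have ct b k (r : seq R) a : size r = N -> (N + 2 <= count_mem a r + count_mem b t')%N ->
    (count_mem a r <= k)%N -> (N.+1 + 2 <= k + count_mem b t)%N.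
  move=> sr le1 le2; have := count_size (pred1 a) r; rewrite sr => le3.
  have : (count_mem b t' < count_mem b t)%N by apply: (count_deriv st Nn0 tE); lia.
  lia.
(* At a root of order at least three the derivative still has a double root, and up to a scalar it
   is the degree [N] convolution of the two derivatives. *)
have [f2|f2] := eqVneq (nconv N.+1 (root_prod s) (root_prod t))^`()^`().[x] 0.
  have [s' ss' sE] := deriv_split ss.
  have fE : (nconv N.+1 (root_prod s) (root_prod t))^`() =
      (N.+1%:R * N.+1%:R) *: nconv N (root_prod s') (root_prod t').
    by rewrite deriv_nconvl ?size_prod_XsubC ?ss ?st // sE nconvZl lower // scalerA.
  move: f1 f2; rewrite fE derivZ !hornerZ => /eqP; rewrite !mulf_eq0 (negPf Nn0) /=.
  move=> /eqP f1 /eqP; rewrite !mulf_eq0 (negPf Nn0) /= => /eqP f2.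
  have [a [b [xab le]]] := IH _ _ ss' st' f1 f2.
  exists a, b; split=> //; apply: (ct _ _ _ _ _ le) => //.
  have [|l2] := leqP (count_mem a s') 1; last first.
    by apply: ltnW; apply: (count_deriv ss Nn0 sE).
  have := count_size (pred1 b) t'; rewrite st' => l1 l2.
  by have := leq_trans le (leq_add l2 l1); rewrite addnC ltnn.
have D : exact_double N t x s by split.
(* At an exact double root, removing [a] leaves a convolution vanishing at [x] by
   [double_root_partial]; if its derivative vanishes as well, the induction hypothesis applies to
   [r] and [t']. *)
have step a r : perm_eq s (a :: r) ->
    (nconv N.+1 (root_prod r) (root_prod t))^`().[x] = 0 ->
  exists a b, x = a + b /\ (N.+1 + 2 <= count_mem a s + count_mem b t)%N.
  move=> pe; have sr : size r = N by have := perm_size pe; rewrite ss /= => -[].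
  have [h0 h1 h2] := exact_double_perm pe D.
  have := double_root_partial st sr h0 h1 h2; rewrite lower // derivZ !hornerZ.
  move=> /eqP + /eqP; rewrite !mulf_eq0 (negPf Nn0) /= => /eqP g0 /eqP g1.
  have [a' [b [xab le]]] := IH _ _ sr st' g0 g1.
  exists a', b; split=> //; apply: (ct _ _ _ _ _ le) => //.
  by rewrite (permP pe) /= leq_addl.
case: s ss f0 f1 f2 D step => // a s [ss] f0 f1 f2 D step.
have [/hasP [c cs /= ca]|/hasPn cst] := boolP (has (predC1 a) s).
  have pe : perm_eq (a :: s) (a :: c :: rem c s) by rewrite perm_cons perm_to_rem.
  have sr : (size (rem c s)).+1 = N.
    by rewrite -ss size_rem // prednK // -has_predT; apply/hasP; exists c.
  have ac : a != c by rewrite eq_sym.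
  case: (double_root_two_blocks st sr ac (exact_double_perm pe D)); first exact: step pe.
  apply: (step c); apply: perm_trans pe _.
  by rewrite -(cat1s a) -(cat1s c) perm_catCA.
have sa : a :: s = nseq N.+1 a.
  rewrite -ss; congr cons; apply/all_pred1P/allP => c /cst /=.
  by rewrite negbK.
(* With all roots of the first factor equal to [a], the convolution is a translate of the second
   factor, whose double root is then [x - a]. *)
have E : nconv N.+1 (root_prod (a :: s)) (root_prod t) =
    N.+1`!%:R *: (root_prod t \Po ('X + (- a)%:P)).
  have -> : root_prod (a :: s) = 'X^(N.+1) \Po ('X + (- a)%:P).
    rewrite sa comp_Xn_poly polyCN; elim: (N.+1) => [|k IHk]; first by rewrite big_nil.
    by rewrite /= big_cons IHk exprS.
  by rewrite nconv_shiftl ?nconv_Xn ?comp_polyZ ?size_polyXn // size_prod_XsubC st.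
have f0' : N.+1`!%:R != 0 :> R by rewrite pnatr_eq0 -lt0n fact_gt0.
exists a, (x - a); split; first by rewrite addrC subrK.
have -> : count_mem a (a :: s) = N.+1 by rewrite sa count_nseq /= eqxx mul1n.
rewrite leq_add2l; apply: count_double_root.
  move: f0; rewrite E hornerZ horner_comp => /eqP; rewrite mulf_eq0 (negPf f0') /=.
  by rewrite !hornerE => /eqP.
move: f1; rewrite E derivZ hornerZ deriv_comp derivD derivX derivC addr0 mulr1 horner_comp.
by move=> /eqP; rewrite mulf_eq0 (negPf f0') /= !hornerE => /eqP.
Qed.

End DoubleRoot.

(** * Block polynomials *)

Lemma nconv_lower_iter (A : comNzRingType) j N (p q : {poly A}) :
  (size p <= N.+1)%N -> nconv (j + N) p q = nconv N p q^`(j).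
Proof.
move=> sp; elim: j q => [//|j IH] q.
by rewrite addSn nconv_lower ?IH -?derivSn // (leq_trans sp) // ltnS leq_addl.
Qed.

Lemma nat_unit (R : numFieldType) k : (0 < k)%N -> (k%:R : R) \is a GRing.unit.
Proof. by move=> k0; rewrite unitfE pnatr_eq0 -lt0n. Qed.

Section BlockPolynomial.
Variable R : rcfType.
Implicit Types (s t z : seq R).

Lemma uniq_count_le1 z : (forall a, (count_mem a z <= 1)%N) -> uniq z.
Proof.
move=> z1; apply: count_mem_uniq => a.
by have := z1 a; rewrite -has_pred1 has_count; case: count => [|[]].
Qed.

Lemma derivn_split k r t : uniq t -> size t = (k + r)%N ->
  exists2 z, uniq z /\ size z = r &
    r`!%:R *: (root_prod t)^`(k) = (k + r)`!%:R *: root_prod z.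
Proof.
move=> ut; elim: k r => [|k IH] r st; first by exists t.
have [|z0 [uz0 sz0] E] := IH r.+1; first by rewrite st addSnnS.
have [z sz E'] := deriv_split sz0; exists z.
  split=> //; apply: uniq_count_le1 => a; rewrite leqNgt; apply/negP => az.
  have := count_deriv sz0 _ E' az; rewrite pnatr_eq0 => /(_ isT) /(leq_ltn_trans az).
  by rewrite (count_uniq_mem _ uz0); case: (a \in z0).
have r0 : r.+1%:R != 0 :> R by rewrite pnatr_eq0.
apply: (scalerI r0); rewrite scalerA -natrM -factS derivnS -derivZ E derivZ E'.
by rewrite !scalerA mulrC addSnnS.
Qed.

(** A double root would require input multiplicities of sum at least [r + 2], while simple inputs
    give at most 2. *)
Lemma nconv_uniq_split r s t : (0 < r)%N -> uniq s -> uniq t ->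
    size s = r -> size t = r ->
  exists2 z, uniq z /\ size z = r &
    nconv r (root_prod s) (root_prod t) = r`!%:R *: root_prod z.
Proof.
move=> r0 us ut ss st; have [z sz E] := nconv_split ss st; exists z => //.
split=> //; apply: uniq_count_le1 => a; rewrite leqNgt; apply/negP => az.
have : ('X - a%:P) ^+ 2 %| root_prod z by rewrite -mup_geq ?root_prod_neq0 // mup_root_prod.
move=> /dvdpP [q zE].
have [||b [c [_]]] := nconv_double_root (x := a) ss st.
- by rewrite E zE hornerZ hornerM horner_exp hornerXsubC subrr expr0n !mulr0.
- rewrite E zE derivZ hornerZ derivM deriv_exp derivXsubC mul1r hornerD !hornerM hornerMn.
  by rewrite !horner_exp hornerXsubC subrr !expr0n /= mul0rn !mulr0 addr0 mulr0.
rewrite !count_uniq_mem //; case: (b \in s); case: (c \in t) => /=; lia.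
Qed.

(** Lowering the degree from [n] to [m] puts [n - m = k - r] derivatives on the second block; after
    an exchange of the factors, lowering from [m] to [r] puts [m - r] derivatives on the first. *)
Lemma block_split n r s t : uniq s -> uniq t -> (size s <= n)%N -> (size t <= n)%N ->
    (size s + size t = n + r)%N -> (0 < r)%N ->
  exists2 z, uniq z /\ size z = r &
    ffconv r ((r`!%:R / (size s)`!%:R) *: (root_prod s)^`(size s - r))
             ((r`!%:R / (size t)`!%:R) *: (root_prod t)^`(size t - r)) = root_prod z
    /\ r`!%:R *: nconv n (root_prod s) (root_prod t)
       = ((size s)`! * (size t)`!)%:R *: root_prod z.
Proof.
move=> us ut sn tn mk r0; set m := size s in sn mk *; set k := size t in tn mk *.
have sm : m = (m - r + r)%N by rewrite subnK //; lia.
have tk : k = (k - r + r)%N by rewrite subnK //; lia.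
have [s' [us' ss'] sE] := derivn_split us sm.
have [t' [ut' st'] tE] := derivn_split ut tk.
rewrite -sm in sE; rewrite -tk in tE.
have f0 j : j`!%:R != 0 :> R by rewrite pnatr_eq0 -lt0n fact_gt0.
have [z [uz sz] zE] := nconv_uniq_split r0 us' ut' ss' st'.
exists z => //.
have sE' : (root_prod s)^`(m - r) = (m`!%:R / r`!%:R) *: root_prod s'.
  by apply: (scalerI (f0 r)); rewrite sE scalerA mulrC divfK.
have tE' : (root_prod t)^`(k - r) = (k`!%:R / r`!%:R) *: root_prod t'.
  by apply: (scalerI (f0 r)); rewrite tE scalerA mulrC divfK.
have one j : r`!%:R / j`!%:R * (j`!%:R / r`!%:R) = 1 :> R.
  by rewrite mulrA divfK // divff.
split.
  rewrite sE' tE' !scalerA !one !scale1r; apply: (scalerI (f0 r)).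
  by rewrite ffconvE ?zE ?size_prod_XsubC ?ss' ?st' //; apply: nat_unit.
have nm : n = (n - m + m)%N by rewrite subnK.
have mr : m = (n - k + r)%N by lia.
rewrite nm nconv_lower_iter ?size_prod_XsubC //.
have -> : (n - m = k - r)%N by lia.
have dsz (p : {poly R}) j e : (size p <= (j + e).+1)%N -> (size p^`(j) <= e.+1)%N.
  elim: j p => [//|j IH] p sp; rewrite derivSn; apply: IH.
  by apply: leq_trans (size_deriv_leq _) _; rewrite -subn1 leq_subLR.
have st1 : (size (root_prod t)^`(k - r) <= r.+1)%N.
  by apply: dsz; rewrite size_prod_XsubC -tk.
rewrite nconvC ?size_prod_XsubC //; last by rewrite (leq_trans st1) // ltnS; lia.
rewrite {1}mr nconv_lower_iter //; have -> : (n - k = m - r)%N by lia.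
have ss1 : (size (root_prod s)^`(m - r) <= r.+1)%N.
  by apply: dsz; rewrite size_prod_XsubC -sm.
rewrite nconvC // sE' tE' nconvZl nconvZr zE !scalerA natrM; congr (_ *: _).
by field; rewrite f0.
Qed.

Lemma block_poly_split n (alpha beta : 'rV[R]_n) (I J : {set 'I_n}) r :
    injective (alpha 0) -> injective (beta 0) -> (#|I| + #|J| = n + r)%N -> (0 < r)%N ->
  exists2 zeta : 'I_r -> R, {homo zeta : i j / (i < j)%N >-> i < j} &
    ffconv r ((r`!%:R / #|I|`!%:R) *: (root_poly_on I alpha)^`(#|I| - r))
           ((r`!%:R / #|J|`!%:R) *: (root_poly_on J beta)^`(#|J| - r))
      = \prod_(l < r) ('X - (zeta l)%:P)
    /\ r`!%:R *: nconv n (root_poly_on I alpha) (root_poly_on J beta)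
       = (#|I|`! * #|J|`!)%:R *: \prod_(l < r) ('X - (zeta l)%:P).
Proof.
move=> ia ib IJ r0.
have onE (K : {set 'I_n}) (a : 'rV[R]_n) :
    root_poly_on K a = root_prod [seq a 0 i | i <- enum K].
  by rewrite /root_poly_on big_map big_enum.
have cK (K : {set 'I_n}) (a : 'rV[R]_n) : size [seq a 0 i | i <- enum K] = #|K|.
  by rewrite size_map -cardE.
have le (K : {set 'I_n}) : (#|K| <= n)%N by rewrite -[X in (_ <= X)%N]card_ord max_card.
have uK (K : {set 'I_n}) (a : 'rV[R]_n) : injective (a 0) ->
    uniq [seq a 0 i | i <- enum K].
  by move=> ai; rewrite map_inj_uniq ?enum_uniq.
have [] := block_split (n := n) (r := r) (uK I _ ia) (uK J _ ib); rewrite ?cK //.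
move=> z [uz sz]; rewrite -!onE => -[E1 E2].
pose z' := sort <=%R z.
have sz' : size z' = r by rewrite size_sort.
have lt_z : sorted <%R z' by rewrite lt_sorted_uniq_le sort_uniq uz sort_le_sorted.
have prodE : root_prod z = \prod_(l < r) ('X - (z'`_l)%:P).
  rewrite -(perm_big _ (permEl (perm_sort <=%R z))) /= -/z' (big_nth 0) sz'.
  by rewrite big_mkord.
exists (fun l => z'`_l); last by rewrite -prodE.
move=> i j ij; rewrite (sorted_ltn_nth lt_trans) // inE sz' ?ltn_ord //.
Qed.

End BlockPolynomial.

Lemma comp_scale_inj (B : idomainType) (L : B) (p q : {poly B}) :
  L != 0 -> p \Po (L *: 'X) = q \Po (L *: 'X) -> p = q.
Proof.
move=> L0 E; apply/polyP => i; apply: (mulfI (expf_neq0 i L0)).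
by rewrite -!coef_comp_scale E.
Qed.

(** Carries an identity between polynomials with scalar roots over to roots multiplied by [L]. As
    [L] is a linear form and not a unit, the identity is compared after ['X] is replaced by
    [L *: 'X]. *)
Lemma nconv_homogenize (B : idomainType) n m k r (p q z p0 q0 z0 : {poly B}) (L c1 c2 : B) :
    L != 0 -> (m + k = n + r)%N ->
    p \Po (L *: 'X) = L ^+ m *: p0 -> q \Po (L *: 'X) = L ^+ k *: q0 ->
    z \Po (L *: 'X) = L ^+ r *: z0 ->
  c1 *: nconv n p0 q0 = c2 *: z0 -> c1 *: nconv n p q = c2 *: z.
Proof.
move=> L0 mk Ep Eq Ez E; apply: (comp_scale_inj L0); rewrite !comp_polyZ Ez.
apply/polyP => i; apply: (mulfI (expf_neq0 n L0)); rewrite -!coefZ; congr (_`_i).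
rewrite scalerA mulrC -scalerA -nconv_scale Ep Eq nconvZl nconvZr [in LHS]scalerA.
rewrite [in LHS]scalerA -exprD mk mulrC -scalerA E !scalerA exprD.
by rewrite mulrAC.
Qed.

(** * Tangent cones *)

Lemma horner_nconv_eval (B : comNzRingType) n (P Q : {poly {poly B}}) (z x : B) :
  (nconv n P Q).[z%:P].[x] =
  (nconv n (map_poly (horner_eval x) P) (map_poly (horner_eval x) Q)).[z].
Proof.
rewrite -map_nconv -[LHS]/(horner_eval x _) -horner_map /= /horner_eval hornerC.
by [].
Qed.

Lemma horner_nconv_scale (B : comNzRingType) n m k (p q p1 q1 : {poly B}) (e z : B) :
    p \Po (e *: 'X) = e ^+ m *: p1 -> q \Po (e *: 'X) = e ^+ k *: q1 ->
  e ^+ n * (nconv n p q).[e * z] = e ^+ (m + k) * (nconv n p1 q1).[z].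
Proof.
move=> Ep Eq.
have -> : (nconv n p q).[e * z] = (nconv n p q \Po (e *: 'X)).[z].
  by rewrite horner_comp hornerZ hornerX.
by rewrite -hornerZ -nconv_scale Ep Eq nconvZl nconvZr !hornerZ mulrA exprD.
Qed.

Section Grading.
Variables (R : realType) (k : nat).
Local Notation A := {mpoly R[k]}.
Implicit Types f g L : A.

(** Every variable is multiplied by a new one, so that homogeneous components become coefficients
    and this map is a ring morphism. *)
Definition grading f : {poly A} :=
  mmap (@polyC A \o @mpolyC k R) (fun i => ('X_i)%:P * 'X) f.

Let gradingC : {rmorphism R -> {poly A}} := @polyC A \o @mpolyC k R.

HB.instance Definition _ := GRing.isAdditive.Build A {poly A} grading
  (@mmap_is_additive k R {poly A} (fun i => ('X_i)%:P * 'X) gradingC).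

HB.instance Definition _ := GRing.isMultiplicative.Build A {poly A} grading
  (@mmap_is_multiplicative k R {poly A} (fun i => ('X_i)%:P * 'X) gradingC).

Lemma coef_grading f e : (grading f)`_e = pihomog mdeg e f.
Proof.
rewrite /grading /mmap coef_sum pihomogE [RHS]big_mkcond; apply: eq_bigr => m _.
have -> : mmap1 (fun i => ('X_i)%:P * 'X) m = ('X_[m])%:P * 'X^(mdeg m) :> {poly A}.
  rewrite /mmap1; under eq_bigr => i _ do rewrite exprMn -polyC_exp.
  rewrite big_split /= -rmorph_prod -mpolyXE_id prodrXr; congr (_ * 'X^_).
  by rewrite mdegE.
rewrite /= mulrA -polyCM coefCM coefXn eq_sym.
by case: eqP => _; rewrite ?mulr1 ?mulr0 // mul_mpolyC.
Qed.

Lemma grading_homog L : L \is 1.-homog -> grading L = L%:P * 'X.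
Proof.
move=> hL; apply/polyP => e; rewrite coef_grading coefCM coefX.
have [->|ne] := eqVneq e 1%N; first by rewrite mulr1 pihomog_dE.
by rewrite mulr0 (pihomog_ne0 _ hL) // eq_sym.
Qed.

Definition zero_set n (d : 'rV[R]_n) : {set 'I_n} := [set i | d 0 i == 0].

Lemma gradingZ c f : grading (c *: f) = c%:MP *: grading f.
Proof. by rewrite -mul_mpolyC rmorphM /= {1}/grading mmapC mul_polyC. Qed.

Definition block_input n (I : {set 'I_n}) (alpha : 'rV[R]_n) (L : A) : {poly A} :=
  \prod_(i in I) ('X - (alpha 0 i *: L)%:P).

(* A factor of the convolution, centred at a root; [d i = 0] exactly on its block. *)
Definition centred_input n (alpha d : 'rV[R]_n) (L T : A) : {poly A} :=
  \prod_(i < n) ('X - (alpha 0 i *: L - d 0 i *: T)%:P).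

(** What remains of the scaled factor once the powers of the scaling variable are extracted. At
    scaling parameter 0 a factor outside the block degenerates to the constant [d 0 i] times the
    constant term of [T]. *)
Definition scaled_input n (alpha d : 'rV[R]_n) (L T : A) : {poly {poly A}} :=
  \prod_(i < n) (if d 0 i == 0 then 'X - (alpha 0 i *: L)%:P%:P
     else ('X : {poly A}) *: ('X - (alpha 0 i *: L)%:P%:P) + ((d 0 i)%:MP *: grading T)%:P).

(* Scaling all variables by ['X] extracts one factor ['X] from every block factor. *)
Lemma map_grading_centred n (alpha d : 'rV[R]_n) L T : L \is 1.-homog ->
  map_poly grading (centred_input alpha d L T) \Po (('X : {poly A}) *: 'X)
  = ('X ^+ #|zero_set d| : {poly A}) *: scaled_input alpha d L T.
Proof.
move=> hL; rewrite /centred_input rmorph_prod /= rmorph_prod /=.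
transitivity (\prod_(i < n) ((if d 0 i == 0 then 'X else 1 : {poly A}) *:
   (if d 0 i == 0 then 'X - (alpha 0 i *: L)%:P%:P
     else ('X : {poly A}) *: ('X - (alpha 0 i *: L)%:P%:P) + ((d 0 i)%:MP *: grading T)%:P))).
  apply: eq_bigr => i _; rewrite rmorphB /= map_polyX map_polyC /=.
  rewrite comp_polyB comp_polyX comp_polyC rmorphB /= !gradingZ grading_homog //.
  have -> : (alpha 0 i)%:MP *: (L%:P * 'X) = 'X * (alpha 0 i *: L)%:P :> {poly A}.
    by rewrite -[alpha 0 i *: L]mul_mpolyC polyCM -mul_polyC mulrA mulrC.
  case: eqP => [->|_]; last first.
    rewrite scale1r scalerBr -['X *: _%:P]mul_polyC -polyCM polyCB opprB.
    by rewrite addrCA addrC.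
  by rewrite mpolyC0 scale0r subr0 scalerBr -[_ *: _%:P]mul_polyC -polyCM.
rewrite scaler_prod /scaled_input; congr (_ *: _).
by rewrite -big_mkcond prodr_const; congr (_ ^+ _); apply: eq_card => i; rewrite inE.
Qed.

Lemma scaled_input0 n (alpha d : 'rV[R]_n) L T (T0 : R) :
  pihomog mdeg 0 T = T0%:MP ->
  map_poly (horner_eval 0) (scaled_input alpha d L T)
  = (\prod_(i | d 0 i != 0) (d 0 i * T0))%:MP *: block_input (zero_set d) alpha L.
Proof.
move=> hT; rewrite /scaled_input rmorph_prod /= (bigID (fun i => d 0 i == 0)) /=.
rewrite mulrC -mul_polyC !rmorph_prod /=; congr (_ * _).
  apply: eq_bigr => i /negPf ->; rewrite rmorphD /= map_polyZ /= map_polyC /=.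
  by rewrite /horner_eval hornerX scale0r add0r hornerZ horner_coef0 coef_grading hT -mpolyCM.
rewrite /block_input; apply: eq_big => [i|i /eqP ->]; first by rewrite inE.
by rewrite eqxx rmorphB /= map_polyX map_polyC /= /horner_eval hornerC.
Qed.

(** Scaling costs ['X^n] on the convolution, while the blocks release one ['X] per index; cancelling
    leaves exactly ['X^r]. *)
Lemma grading_nconv n r (alpha beta d e : 'rV[R]_n) L1 L2 T :
    L1 \is 1.-homog -> L2 \is 1.-homog ->
    (#|zero_set d| + #|zero_set e| = n + r)%N ->
  grading (nconv n (centred_input alpha d L2 T) (centred_input beta e L2 T)).[L1]
  = 'X^r * (nconv n (scaled_input alpha d L2 T) (scaled_input beta e L2 T)).[L1%:P].
Proof.
move=> h1 h2 mk.
have hp := map_grading_centred alpha d T h2; have hq := map_grading_centred beta e T h2.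
have E := horner_nconv_scale n L1%:P hp hq.
have X0 : 'X^n != 0 :> {poly A} by rewrite -size_poly_eq0 size_polyXn.
apply: (mulfI X0); rewrite mulrA -exprD -mk -E; congr (_ * _).
rewrite -horner_map /= map_nconv grading_homog //.
by congr (_.[_]); rewrite mulrC.
Qed.

Lemma lowest_nconv n r (alpha beta d e : 'rV[R]_n) L1 L2 T T0 f :
    L1 \is 1.-homog -> L2 \is 1.-homog -> pihomog mdeg 0 T = T0%:MP ->
    (#|zero_set d| + #|zero_set e| = n + r)%N ->
    f = (nconv n (centred_input alpha d L2 T) (centred_input beta e L2 T)).[L1] ->
  (forall j, (j < r)%N -> pihomog mdeg j f = 0) /\
  pihomog mdeg r f =
    ((\prod_(i | d 0 i != 0) (d 0 i * T0)) * (\prod_(i | e 0 i != 0) (e 0 i * T0))) *: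
    (nconv n (block_input (zero_set d) alpha L2) (block_input (zero_set e) beta L2)).[L1].
Proof.
move=> h1 h2 hT mk fE; have E := grading_nconv alpha beta T h1 h2 mk.
rewrite -fE in E; clear fE; split=> [j jr|]; rewrite -coef_grading E coefXnM; first by rewrite jr.
rewrite ltnn subnn -horner_coef0 horner_nconv_eval.
rewrite (scaled_input0 _ _ _ hT) (scaled_input0 _ _ _ hT) nconvZl nconvZr !hornerZ.
by rewrite mulrA -mpolyCM mul_mpolyC.
Qed.

Lemma block_input_scale n (I : {set 'I_n}) (alpha : 'rV[R]_n) L :
  block_input I alpha L \Po (L *: 'X) =
  L ^+ #|I| *: map_poly (@mpolyC k R) (root_poly_on I alpha).
Proof.
rewrite /block_input /root_poly_on !rmorph_prod /= -[X in _ = X *: _]prodr_const.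
rewrite -scaler_prod; apply: eq_bigr => i _.
rewrite comp_polyB comp_polyX comp_polyC rmorphB /= map_polyX map_polyC /= scalerBr.
by rewrite -[_ *: _%:P]mul_polyC -polyCM -mul_mpolyC mulrC.
Qed.

Lemma nconv_block_input n r (I J : {set 'I_n}) (alpha beta : 'rV[R]_n) L (c1 c2 : R)
    (zeta : 'I_r -> R) :
    L != 0 -> (#|I| + #|J| = n + r)%N ->
    c1 *: nconv n (root_poly_on I alpha) (root_poly_on J beta)
      = c2 *: \prod_(l < r) ('X - (zeta l)%:P) ->
  c1%:MP *: nconv n (block_input I alpha L) (block_input J beta L)
  = c2%:MP *: \prod_(l < r) ('X - (zeta l *: L)%:P).
Proof.
move=> L0 mk E.
have hI := block_input_scale I alpha L; have hJ := block_input_scale J beta L.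
have hZ : (\prod_(l < r) ('X - (zeta l *: L)%:P)) \Po (L *: 'X) =
    L ^+ r *: map_poly (@mpolyC k R) (\prod_(l < r) ('X - (zeta l)%:P)).
  rewrite !rmorph_prod /= -[X in L ^+ X]card_ord -prodr_const -scaler_prod.
  apply: eq_bigr => i _.
  rewrite comp_polyB comp_polyX comp_polyC rmorphB /= map_polyX map_polyC /= scalerBr.
  by rewrite -[_ *: _%:P]mul_polyC -polyCM -mul_mpolyC mulrC.
apply: (nconv_homogenize L0 mk hI hJ hZ).
by rewrite -map_nconv -!map_polyZ E.
Qed.

End Grading.

Lemma mpoly_nat_unit (R : realType) j k : (0 < k)%N -> (k%:R : {mpoly R[j]}) \is a GRing.unit.
Proof.
move=> k0; apply/unitrPr; exists (k%:R^-1)%:MP.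
by rewrite -[k%:R]mpolyC_nat -mpolyCM divff // pnatr_eq0 -lt0n.
Qed.

Lemma root_polyE (A : comNzRingType) n (a : 'rV[A]_n) :
  root_poly a = root_prod [seq a 0 i | i <- enum 'I_n].
Proof. by rewrite big_map big_enum. Qed.

Lemma size_root_poly (A : comNzRingType) n (a : 'rV[A]_n) : size (root_poly a) = n.+1.
Proof. by rewrite root_polyE size_prod_XsubC size_map size_enum_ord. Qed.

Lemma map_root_poly (A B : comNzRingType) (f : {rmorphism A -> B}) n (a : 'rV[A]_n) :
  map_poly f (root_poly a) = root_poly (map_mx f a).
Proof.
rewrite rmorph_prod; apply: eq_bigr => i _.
by rewrite rmorphB /= map_polyX map_polyC mxE.
Qed.

Definition shift_poly (A : comNzRingType) (a : A) (p : {poly A}) : {poly A} :=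
  p \Po ('X + a%:P).

Lemma horner_nconv_shift (A : comNzRingType) n (p q : {poly A}) (x a b : A) :
    (size p <= n.+1)%N -> (size q <= n.+1)%N ->
  (nconv n p q).[x] =
  (nconv n (shift_poly a p) (shift_poly b q)).[x - (a + b)].
Proof.
move=> sp sq; rewrite /shift_poly nconv_shiftr nconv_shiftl // !horner_comp !hornerE.
by congr (_.[_]); ring.
Qed.

(** * Lowest form of the curve equation under a substitution *)

Section LocalForm.
Variables (R : realType) (n : nat) (alpha beta u v : 'rV[R]_n).
Local Notation h := (curve_poly alpha beta u v).

Section Substitution.
Variables (k : nat) (phi : {rmorphism {mpoly R[3]} -> {mpoly R[k]}}).
Hypothesis phiC : forall c : R, phi c%:MP = c%:MP.
Local Notation x := (phi 'X_cx).
Local Notation y := (phi 'X_cy).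
Local Notation t := (phi 'X_ct).

Lemma subst_curve_poly : n`!%:R * phi h =
  (nconv n (root_poly (\row_i (alpha 0 i *: y + u 0 i *: t)))
           (root_poly (\row_i (beta 0 i *: y + v 0 i *: t)))).[x].
Proof.
have E (a w : 'rV[R]_n) :
    map_poly phi (root_poly (generic_input a w)) = root_poly (\row_i (a 0 i *: y + w 0 i *: t)).
  rewrite map_root_poly; congr root_poly; apply/rowP => i.
  by rewrite !mxE rmorphD !rmorphM /= !phiC mulrC (mulrC t) !mul_mpolyC.
rewrite -!E -map_nconv horner_map -ffconvE ?size_root_poly //; last exact: mpoly_nat_unit.
by rewrite hornerZ rmorphM rmorph_nat.
Qed.

(** Rests on [al y + w t = al (y + c t) + (w - c al) t]: indices with [w - c al = a] lose their
    multiple of [t] after the shift by [a t]. *)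
Lemma centred_root_poly (a c : R) (al w : 'rV[R]_n) :
  shift_poly (a *: t) (root_poly (\row_i (al 0 i *: y + w 0 i *: t))) =
  centred_input al (\row_i (a - (w 0 i - c * al 0 i))) (y + c *: t) t.
Proof.
rewrite /shift_poly /root_poly /centred_input rmorph_prod; apply: eq_bigr => i _ /=.
rewrite !mxE comp_polyB comp_polyX comp_polyC -addrA -polyCB; congr ('X + _).
rewrite -polyCN; congr (_%:P).
rewrite scalerDr !scalerBl scalerA [c * _]mulrC.
by rewrite !opprD !opprK; ring.
Qed.

(** An arbitrary [phi] fixing constants covers all affine charts at once; [T0] is the constant term
    of the image of [t]. The scalar [s] collects the nonzero values of the factors outside the
    blocks and the factorials. *)
Lemma lowest_subst_curve_poly (a b c T0 : R) (r : nat) (zeta : 'I_r -> R) :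
    let I := [set i : 'I_n | u 0 i - c * alpha 0 i == a] in
    let J := [set j : 'I_n | v 0 j - c * beta 0 j == b] in
    (#|I| + #|J| = n + r)%N ->
    r`!%:R *: nconv n (root_poly_on I alpha) (root_poly_on J beta)
      = (#|I|`! * #|J|`!)%:R *: \prod_(l < r) ('X - (zeta l)%:P) ->
    let L1 := x - (a + b) *: t in let L2 := y + c *: t in
    L1 \is 1.-homog -> L2 \is 1.-homog -> L2 != 0 ->
    pihomog mdeg 0 t = T0%:MP -> T0 != 0 ->
    (forall l, L1 - zeta l *: L2 != 0) ->
  exists2 s : R, s != 0 &
    lowest_form (phi h) r (s *: \prod_(l < r) (L1 - zeta l *: L2)).
Proof.
move=> I J mk bE L1 L2 h1 h2 L20 hT T00 Lz.
pose d : 'rV[R]_n := \row_i (a - (u 0 i - c * alpha 0 i)).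
pose e : 'rV[R]_n := \row_i (b - (v 0 i - c * beta 0 i)).
have dI : zero_set d = I by apply/setP => i; rewrite !inE mxE subr_eq0 eq_sym.
have eJ : zero_set e = J by apply/setP => i; rewrite !inE mxE subr_eq0 eq_sym.
have fE : n`!%:R *: phi h =
    (nconv n (centred_input alpha d L2 t) (centred_input beta e L2 t)).[L1].
  rewrite -mul_mpolyC mpolyC_nat subst_curve_poly.
  have E1 := centred_root_poly a c alpha u; have E2 := centred_root_poly b c beta v.
  set p := root_poly _ in E1 *; set q := root_poly _ in E2 *.
  have sp : (size p <= n.+1)%N by rewrite size_root_poly.
  have sq : (size q <= n.+1)%N by rewrite size_root_poly.
  clearbody p q.
  have E3 := horner_nconv_shift x (a *: t) (b *: t) sp sq.
  rewrite E1 E2 in E3.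
  by rewrite /L1 scalerDl.
have mk' : (#|zero_set d| + #|zero_set e| = n + r)%N by rewrite dI eJ.
have [lo hi] := lowest_nconv h1 h2 hT mk' fE.
rewrite dI eJ in hi.
have f0 j : j`!%:R != 0 :> R by rewrite pnatr_eq0 -lt0n fact_gt0.
have bh := nconv_block_input L20 mk bE.
have {}bh : (nconv n (block_input I alpha L2) (block_input J beta L2)).[L1] =
    ((#|I|`! * #|J|`!)%:R / r`!%:R) *: \prod_(l < r) (L1 - zeta l *: L2).
  have := congr1 (fun p => p.[L1]) bh; rewrite /= !hornerZ horner_prod !mul_mpolyC => bh'.
  apply: (scalerI (f0 r)); rewrite bh' scalerA mulrC divfK //; congr (_ *: _).
  by apply: eq_bigr => l _; rewrite hornerXsubC.
set s0 := \prod_(i | _) _ * _ in hi.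
have s00 : s0 != 0.
  by rewrite mulf_neq0 //; apply/prodf_neq0 => i di; rewrite mulf_neq0.
set s1 := (#|I|`! * #|J|`!)%:R / r`!%:R in bh.
have s10 : s1 != 0 by rewrite /s1 natrM !mulf_neq0 ?invr_eq0 ?f0.
have s20 : n`!%:R^-1 * (s0 * s1) != 0.
  exact: mulf_neq0 (invr_neq0 (f0 n)) (mulf_neq0 s00 s10).
have gE : pihomog mdeg r (phi h) =
    (n`!%:R^-1 * (s0 * s1)) *: \prod_(l < r) (L1 - zeta l *: L2).
  apply: (scalerI (f0 n)); rewrite linearZ /= in hi; rewrite hi bh !scalerA; congr (_ *: _).
  by rewrite [RHS]mulrA divff // mul1r.
exists (n`!%:R^-1 * (s0 * s1)) => //.
split=> //.
  rewrite -mul_mpolyC mulf_neq0 //; last by apply/prodf_neq0.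
  by rewrite mpolyC_eq0.
move=> j jr; apply: (scalerI (f0 n)).
by have := lo _ jr; rewrite linearZ /= => ->; rewrite scaler0.
Qed.

End Substitution.
End LocalForm.

(** * Affine charts and tangent directions *)

Section Chart.
Variables (R : realType) (P : 'I_3 -> R) (k : 'I_3).
Hypothesis Pk : P k != 0.

Definition chart_dir (j : 'I_3) : {mpoly R[2]} :=
  if unlift k j is Some i then 'X_i else 0.

Lemma chart_dir_homog j : chart_dir j \is 1.-homog.
Proof.
rewrite /chart_dir; case: unlift => [i|]; last exact: dhomog0.
by rewrite dhomogX /= mdeg1.
Qed.

Definition chart : 3.-tuple {mpoly R[2]} :=
  [tuple if unlift k j is Some i then (P j / P k)%:MP + 'X_i else 1 | j < 3].

Lemma chartE j : 'X_j \mPo chart = (P j / P k)%:MP + chart_dir j.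
Proof.
rewrite comp_mpolyXU -tnth_nth tnth_mktuple /chart_dir.
by case: unliftP => [i|->] //; rewrite divff // mpolyC1 addr0.
Qed.

(* The value at [w] of a linear form that vanishes at [P]. *)
Lemma meval_chart_dir (w : 'I_3 -> R) j :
  (chart_dir j).@[fun i => w (lift k i) - w k / P k * P (lift k i)]
  = w j - w k / P k * P j.
Proof.
rewrite /chart_dir; case: unliftP => [i ->|->]; first by rewrite mevalXU.
by rewrite meval0 divfK // subrr.
Qed.

Section Tangent.
Variables (n : nat) (alpha beta u v : 'rV[R]_n) (a b c : R).
Hypotheses (Pt : P ct != 0) (Px : P cx = (a + b) * P ct) (Py : P cy = - c * P ct).

Definition tangent_x : {mpoly R[2]} := chart_dir cx - (a + b) *: chart_dir ct.
Definition tangent_y : {mpoly R[2]} := chart_dir cy + c *: chart_dir ct.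

(** The forms [x - (a + b) t] and [y + c t] vanish at [P], so the correction by a multiple of [P]
    disappears; independence can thus be tested in homogeneous coordinates, uniformly in the
    chart. *)
Lemma meval_tangent (w : 'I_3 -> R) : exists p : 'I_2 -> R,
  tangent_x.@[p] = w cx - (a + b) * w ct /\ tangent_y.@[p] = w cy + c * w ct.
Proof.
exists (fun i => w (lift k i) - w k / P k * P (lift k i)).
rewrite /tangent_x /tangent_y mevalB mevalD !mevalZ !meval_chart_dir Px Py.
by split; ring.
Qed.

Lemma tangent_independent (z1 z2 : R) :
  z1 *: tangent_x + z2 *: tangent_y = 0 -> z1 = 0 /\ z2 = 0.
Proof.
move=> E; have [p1 [x1 y1]] := meval_tangent (pt 1 0 0).
have [p2 [x2 y2]] := meval_tangent (pt 0 1 0).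
have := congr1 (meval p1) E; have := congr1 (meval p2) E.
rewrite !mevalD !mevalZ !meval0 x1 x2 y1 y2 /pt !(tnth_nth 0) /=.
by rewrite !(mulr0, oppr0, subr0, addr0, mulr1, add0r) => -> ->.
Qed.

Lemma tangent_homog (z1 z2 : R) : z1 *: tangent_x + z2 *: tangent_y \is 1.-homog.
Proof.
have hZ (z : R) (L : {mpoly R[2]}) : L \is 1.-homog -> z *: L \is 1.-homog by apply: dhomogZ.
rewrite dhomogD // hZ // /tangent_x /tangent_y.
  by rewrite dhomogD ?chart_dir_homog // -scaleNr hZ // chart_dir_homog.
by rewrite dhomogD ?chart_dir_homog // hZ // chart_dir_homog.
Qed.

Lemma lowest_local_eq (r : nat) (zeta : 'I_r -> R) :
    let I := [set i : 'I_n | u 0 i - c * alpha 0 i == a] in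
    let J := [set j : 'I_n | v 0 j - c * beta 0 j == b] in
    (#|I| + #|J| = n + r)%N ->
    r`!%:R *: nconv n (root_poly_on I alpha) (root_poly_on J beta)
      = (#|I|`! * #|J|`!)%:R *: \prod_(l < r) ('X - (zeta l)%:P) ->
  exists2 s : R, s != 0 &
    lowest_form (local_eq (curve_poly alpha beta u v) P k) r
      (s *: \prod_(l < r) (tangent_x - zeta l *: tangent_y)).
Proof.
move=> I J mk bE.
pose phi : {rmorphism {mpoly R[3]} -> {mpoly R[2]}} := comp_mpoly chart.
have phiX j : phi 'X_j = (P j / P k)%:MP + chart_dir j by exact: chartE.
have Ex : phi 'X_cx - (a + b) *: phi 'X_ct = tangent_x.
  rewrite !phiX Px /tangent_x scalerDr -mul_mpolyC -mpolyCM mulrA opprD addrACA.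
  by rewrite subrr add0r.
have Ey : phi 'X_cy + c *: phi 'X_ct = tangent_y.
  rewrite !phiX Py /tangent_y scalerDr -mul_mpolyC -mpolyCM addrACA -mpolyCD.
  by rewrite mulNr mulNr mulrA addNr mpolyC0 add0r.
have hx : tangent_x \is 1.-homog.
  by have := tangent_homog 1 0; rewrite scale1r scale0r addr0.
have hy : tangent_y \is 1.-homog.
  by have := tangent_homog 0 1; rewrite scale1r scale0r add0r.
have y0 : tangent_y != 0.
  apply/eqP => y0; have [|_ /eqP] := @tangent_independent 0 1.
    by rewrite y0 scaler0 scale0r addr0.
  by rewrite oner_eq0.
have l0 l : tangent_x - zeta l *: tangent_y != 0.
  apply/eqP => E; have [|/eqP] := @tangent_independent 1 (- zeta l).
    by rewrite scale1r scaleNr.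
  by rewrite oner_eq0.
have hT : pihomog mdeg 0 (phi 'X_ct) = (P ct / P k)%:MP.
  rewrite phiX pihomogD (pihomog_ne0 _ (chart_dir_homog _)) // addr0.
  by rewrite pihomog_dE // -[_%:MP]mulr1 mul_mpolyC dhomogZ // dhomog1.
have T0 : P ct / P k != 0 by rewrite mulf_neq0 ?invr_eq0.
have phiC (z : R) : phi z%:MP = z%:MP by exact: comp_mpolyC.
have := lowest_subst_curve_poly phiC mk bE; rewrite Ex Ey.
by move=> /(_ _ hx hy y0 hT T0 l0).
Qed.

End Tangent.
End Chart.

(** * Singular points *)

Section LinePoly.
Variable R : realType.
Implicit Types (g : {mpoly R[3]}) (y t z : R) (P : 'I_3 -> R).

(** Restricting to a line with [y] and [t] fixed turns a singular point of the curve into a double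
    output root. *)
Definition line_poly y t g : {poly R} := mmap (@polyC R) (pt 'X y%:P t%:P) g.

Lemma prod_ord3 (A : comNzRingType) (F : 'I_3 -> A) :
  \prod_(i < 3) F i = F cx * (F cy * F ct).
Proof.
rewrite !big_ord_recl big_ord0 mulr1.
by congr (F _ * (F _ * F _)); apply: val_inj.
Qed.

Lemma ptE (T : Type) (x y t : T) : (pt x y t cx = x) * (pt x y t cy = y) * (pt x y t ct = t).
Proof. by rewrite /pt !(tnth_nth x). Qed.

Lemma horner_line_poly y t g z : (line_poly y t g).[z] = g.@[pt z y t].
Proof.
rewrite /line_poly /mmap horner_sum mevalE; apply: eq_bigr => m _.
by rewrite hornerM hornerC /mmap1 !prod_ord3 !ptE !hornerM !horner_exp !hornerC hornerX.
Qed.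

Lemma deriv_line_poly y t g : (line_poly y t g)^`() = line_poly y t g^`M(cx).
Proof.
elim/mpolyind: g => [|c m g _ _ IH]; first by rewrite mderiv0 /line_poly mmap0 linear0.
rewrite mderivD mderivZ mderivX /line_poly !mmapD derivD -/(line_poly y t g) IH.
congr (_ + _); rewrite !mmapZ !mmapX derivM derivC mul0r add0r.
congr (_ * _); rewrite /mmap1 !prod_ord3 !ptE !mnmBE !mnm1E /= !subn0.
rewrite derivM derivXn -!rmorphXn -polyCM derivC mulr0 addr0 subn1.
by rewrite polyC_natr mulr_natl mulrnAl.
Qed.

Lemma meval_pt P g : g.@[P] = g.@[pt (P cx) (P cy) (P ct)].
Proof.
rewrite !mevalE; apply: eq_bigr => m _; congr (_ * _).
by rewrite !prod_ord3 !ptE.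
Qed.

Lemma poly_fun_inj (p q : {poly R}) : (forall z, p.[z] = q.[z]) -> p = q.
Proof.
move=> E; apply/eqP; rewrite -subr_eq0; apply/negPn/negP => /exists_nonroot [z].
by rewrite rootE hornerD hornerN E subrr eqxx.
Qed.
End LinePoly.

Lemma count_mem_enum (A : eqType) n (F : 'I_n -> A) x :
  count_mem x [seq F i | i <- enum 'I_n] = #|[set i | F i == x]|.
Proof.
rewrite count_map -sum1_count big_enum_cond sum1dep_card.
by apply: eq_card => i; rewrite !inE.
Qed.

Section Curve.
Variables (R : realType) (n : nat) (alpha beta u v : 'rV[R]_n).
Hypotheses (n2 : (2 <= n)%N) (alphaI : injective (alpha 0)) (betaI : injective (beta 0)).
Local Notation h := (curve_poly alpha beta u v).

Lemma singular_blocks P : singular_point h P -> exists a b c,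
  [/\ P ct != 0, P cx = (a + b) * P ct, P cy = - c * P ct &
   (n + 2 <= #|[set i : 'I_n | (u 0 i - c * alpha 0 i == a)%R]|
           + #|[set j : 'I_n | (v 0 j - c * beta 0 j == b)%R]|)%N].
Proof.
move=> [[j0 Pj0] h0 h1]; set y := P cy; set t := P ct.
pose s := [seq (y *: alpha + t *: u) 0 i | i <- enum 'I_n].
pose s' := [seq (y *: beta + t *: v) 0 i | i <- enum 'I_n].
have ss : size s = n by rewrite size_map size_enum_ord.
have ss' : size s' = n by rewrite size_map size_enum_ord.
have fE : line_poly y t h = ffconv n (root_prod s) (root_prod s').
  by apply: poly_fun_inj => z; rewrite horner_line_poly curve_polyE !root_polyE.
have nE : nconv n (root_prod s) (root_prod s') = n`!%:R *: line_poly y t h.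
  by rewrite fE ffconvE ?size_prod_XsubC ?ss ?ss' //; apply: nat_unit.
have [||a' [b' [xE le]]] := @nconv_double_root R n s s' (P cx) ss ss'.
- by rewrite nE hornerZ horner_line_poly -meval_pt h0 mulr0.
- by rewrite nE derivZ hornerZ deriv_line_poly horner_line_poly -meval_pt h1 mulr0.
rewrite !count_mem_enum in le.
have leK (K : {set 'I_n}) : (#|K| <= n)%N by rewrite -[X in (_ <= X)%N]card_ord max_card.
(* If [y = t = 0], all inputs are 0, which forces [x = 0] and no projective point is left. If
   [t = 0] and [y] is nonzero, the inputs are simple and their multiplicities cannot add up to
   [n + 2]. *)
have t0 : t != 0.
  apply/eqP => t0; have [y0|y0] := eqVneq y 0.
    have zero (w1 w2 : 'rV[R]_n) z :
        (2 <= #|[set i | ((y *: w1 + t *: w2) 0 i == z)%R]|)%N -> z = 0.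
      by move=> /ltnW /card_gt0P [l]; rewrite inE y0 t0 !scale0r addr0 mxE eq_sym => /eqP.

    have l1 := leK [set i | (y *: alpha + t *: u) 0 i == a'].
    have l2 := leK [set i | (y *: beta + t *: v) 0 i == b'].
    have x0 : P cx = 0.
      have a0 : a' = 0.
        apply: (zero alpha u).
        by have := leq_trans le (leq_add (leqnn _) l2); rewrite addnC leq_add2r.
      have b0 : b' = 0.
        apply: (zero beta v).
        by have := leq_trans le (leq_add l1 (leqnn _)); rewrite leq_add2l.
      by rewrite xE a0 b0 addr0.
    case/negP: Pj0; apply/eqP; case: j0 => [[|[|[|//]]]] lt.
    + by rewrite -[RHS]x0; congr P; apply: val_inj.
    + by rewrite -[RHS]y0; congr P; apply: val_inj.
    + by rewrite -[RHS]t0; congr P; apply: val_inj.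
  have one (w1 w2 : 'rV[R]_n) z : injective (w1 0) ->
      (#|[set i | ((y *: w1 + t *: w2) 0 i == z)%R]| <= 1)%N.
    move=> wi; apply/card_le1_eqP => i j; rewrite !inE t0 scale0r addr0 !mxE.
    by move=> /eqP <- /eqP /(mulfI y0) /wi.
  have := leq_trans le (leq_add (one _ _ _ alphaI) (one _ _ _ betaI)).
  by rewrite addn2 addn1 !ltnS leqn0 => /eqP n0; move: n2; rewrite n0.
exists (a' / t), (b' / t), (- y / t); split=> //.
- by rewrite -mulrDl divfK.
- by rewrite mulNr divfK // opprK.
have E (w1 w2 : 'rV[R]_n) z : [set i | w2 0 i - (- y / t) * w1 0 i == z / t] =
    [set i | (y *: w1 + t *: w2) 0 i == z].
  apply/setP => i; rewrite !inE !mxE -[LHS](inj_eq (mulIf t0)) divfK //; congr (_ == _).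
  by field.
by rewrite !E.
Qed.

(** For distinct parameters the two blocks on one side share at most one index, as the coordinates
    of [alpha] and [beta] are distinct. The four cardinals then add up to at most [2n + 2], against
    the required [2n + 4]. *)
Lemma blocks_same_ratio (a b c a' b' c' : R) :
    (n + 2 <= #|[set i : 'I_n | (u 0 i - c * alpha 0 i == a)%R]|
           + #|[set j : 'I_n | (v 0 j - c * beta 0 j == b)%R]|)%N ->
    (n + 2 <= #|[set i : 'I_n | (u 0 i - c' * alpha 0 i == a')%R]|
           + #|[set j : 'I_n | (v 0 j - c' * beta 0 j == b')%R]|)%N ->
  c = c'.
Proof.
move=> le1 le2; apply/eqP/negPn/negP => cc.
have one (w1 w2 : 'rV[R]_n) (z z' : R) : injective (w1 0) ->
    (#|[set i : 'I_n | (w2 0 i - c * w1 0 i == z)%R]|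
     + #|[set i : 'I_n | (w2 0 i - c' * w1 0 i == z')%R]| <= n + 1)%N.
  move=> wi; rewrite -cardsUI leq_add //.
    by rewrite -[X in (_ <= X)%N]card_ord max_card.
  apply/card_le1_eqP => i j; rewrite !inE => /andP[/eqP i1 /eqP i2] /andP[/eqP j1 /eqP j2].
  apply: wi; apply: (@mulfI _ (c - c')); first by rewrite subr_eq0.
  transitivity (z' - z); first by rewrite -j1 -j2; ring.
  by rewrite -i1 -i2; ring.
have := leq_add (one _ u a a' alphaI) (one _ v b b' betaI).
rewrite addnACA leqNgt; apply/negP; rewrite negbK.
by apply: leq_trans (leq_add le1 le2); lia.
Qed.

Lemma singular_ordinary P : singular_point h P ->
  exists2 r : nat, (2 <= r)%N & ordinary_real_point h P r.
Proof.
move=> sP; have [a [b [c [Pt Px Py le]]]] := singular_blocks sP.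
set I := [set i | _] in le; set J := [set i | _] in le.
pose r := (#|I| + #|J| - n)%N.
have mk : (#|I| + #|J| = n + r)%N.
  by rewrite /r subnKC // (leq_trans _ le) // leq_addr.
have r2 : (2 <= r)%N by rewrite -(leq_add2l n) -mk.
exists r => // k Pk.
have [zeta zI [_ bE]] := block_poly_split alphaI betaI mk (ltnW r2).
have [s s0 low] := lowest_local_eq Pk Pt Px Py mk bE.
set X := tangent_x k a b in low; set Y := tangent_y k c in low.
have r0 : (0 < r)%N by apply: ltnW.
pose i0 := Ordinal r0.
(* The scalar [s] is absorbed into a single linear factor. *)
pose m (i : 'I_r) : R := if i == i0 then s else 1.
have m0 i : m i != 0 by rewrite /m; case: ifP => _ //; rewrite oner_eq0.
exists (fun i => m i *: (X - zeta i *: Y)); split.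
- move=> i; rewrite scalerBr scalerA -scaleNr.
  exact: tangent_homog.
- move=> i j ij d; apply/eqP => E.
  (* Proportionality of two factors is a linear relation between [X] and [Y]; its vanishing
     coefficients force [zeta i = zeta j]. *)
  have [|E1 E2] := tangent_independent Pk Px Py
    (z1 := m i - d * m j) (z2 := d * m j * zeta j - m i * zeta i).
    move/eqP: E; rewrite -subr_eq0 => /eqP <-; rewrite -/X -/Y; clearbody X Y.
    rewrite !scalerBr !scalerBl !scalerA opprB addrACA [RHS]addrACA.
    by congr (_ + _); exact: addrC.
  have ne : zeta i != zeta j.
    case: (ltngtP i j) => [lt|lt|/val_inj eq]; last by rewrite eq eqxx in ij.
      by rewrite lt_eqF // zI.
    by rewrite gt_eqF // zI.
  have dm : d * m j = m i by apply/eqP; rewrite eq_sym -subr_eq0 E1.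
  move/eqP: E2; rewrite dm -mulrBr mulf_eq0 (negPf (m0 i)) subr_eq0 eq_sym.
  by rewrite (negPf ne).
suff -> : \prod_(i < r) (m i *: (X - zeta i *: Y)) = s *: \prod_(l < r) (X - zeta l *: Y) by [].
rewrite scaler_prod; congr (_ *: _); rewrite (bigD1 i0) //= big1 ?mulr1.
  by rewrite /m eqxx.
by move=> i /negPf ni; rewrite /m ni.
Qed.

Lemma mup_root_poly (a c : R) (w1 w2 : 'rV[R]_n) :
  mup a (root_poly (w2 - c *: w1)) = #|[set i : 'I_n | w2 0 i - c * w1 0 i == a]|.
Proof.
rewrite root_polyE mup_root_prod count_mem_enum; apply: eq_card => i.
by rewrite !inE !mxE.
Qed.

End Curve.

Lemma chart_dir_ct (R : realType) :
  (chart_dir R ct cx = 'X_cX) * (chart_dir R ct cy = 'X_cY) * (chart_dir R ct ct = 0).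
Proof.
rewrite /chart_dir unlift_none.
have -> : cx = lift ct cX by apply: val_inj.
have -> : cy = lift ct cY by apply: val_inj.
by rewrite !liftK.
Qed.

Theorem theorem7p1 (R : realType) (n : nat) (alpha beta u v : 'rV[R]_n) :
  (2 <= n)%N ->
  injective (alpha 0) -> injective (beta 0) ->
  let h := curve_poly alpha beta u v in
  [/\ forall P : 'I_3 -> R, singular_point h P ->
        exists2 r : nat, (2 <= r)%N & ordinary_real_point h P r,
      exists y0 t0 : R, ((y0 != 0) || (t0 != 0)) /\
        forall P : 'I_3 -> R, singular_point h P -> lies_over P y0 t0 &
      forall (c a b : R) (r : nat),
        producing_roots n (root_poly (u - c *: alpha))
                          (root_poly (v - c *: beta)) a b r ->
        let I := [set i : 'I_n | u 0 i - c * alpha 0 i == a] in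
        let J := [set j : 'I_n | v 0 j - c * beta 0 j == b] in
        r = (#|I| + #|J| - n)%N /\
        exists zeta : 'I_r -> R,
          [/\ {homo zeta : i j / (i < j)%N >-> i < j},
              block_poly alpha beta I J r
                = \prod_(l < r) ('X - (zeta l)%:P) &
              exists2 s : R, s != 0 &
                lowest_form (local_eq h (pt (a + b) (- c) 1) ct) r
                  (s *: \prod_(l < r) ('X_cX - zeta l *: 'X_cY))]].
Proof.
move=> n2 aI bI h; split.
- by move=> P; apply: singular_ordinary.
- have [[P sP]|no] := pselect (exists P, singular_point h P); last first.
    (* Without singular points any parameter serves. *)
    by exists 1, 0; split=> [|P sP]; [rewrite oner_eq0|case: no; exists P].
  have [a [b [c [Pt _ Py le]]]] := singular_blocks n2 aI bI sP.
  exists (- c), 1; split=> [|P' sP']; first by rewrite oner_eq0 orbT.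
  have [a' [b' [c' [Pt' _ Py' le']]]] := singular_blocks n2 aI bI sP'.
  exists (P' ct); first by [].
  by rewrite (blocks_same_ratio n2 aI bI le le') mulr1 Py' mulrC.
move=> c a b r [_ _ _ r2]; rewrite !mup_root_poly => mk I J.
split; first by rewrite mk addKn.
have [zeta zI [zE bE]] := block_poly_split aI bI mk (ltnW r2).
exists zeta; split=> //.
have [Ex [Ey Et]] : pt (a + b) (- c) 1 cx = a + b /\ pt (a + b) (- c) 1 cy = - c
    /\ pt (a + b) (- c) 1 ct = 1 by rewrite !ptE.
have Pt : pt (a + b) (- c) 1 ct != 0 by rewrite Et oner_eq0.
have Px : pt (a + b) (- c) 1 cx = (a + b) * pt (a + b) (- c) 1 ct by rewrite Ex Et mulr1.
have Py : pt (a + b) (- c) 1 cy = - c * pt (a + b) (- c) 1 ct by rewrite Ey Et mulr1.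
have [s s0 low] := lowest_local_eq Pt Pt Px Py mk bE.
exists s => //; move: low.
(* In the chart [t = 1] the coordinate [t] has no linear part, so the two tangent forms are the
   affine coordinates themselves. *)
by rewrite /tangent_x /tangent_y !chart_dir_ct !scaler0 subr0 addr0.
Qed.
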